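(* Let $R$ be an order in $K$ with maximal order $\mathcal O$, let $\mathcal S$ be a set of maximal ideals of $R$, and let $\mathcal S_0$ be the finite subset of $\mathcal S$ consisting of maximal ideals containing the conductor $(R:\mathcal O)$. For each maximal ideal $\mathfrak p$ let $n_{\mathfrak p}$ be a positive integer with $(\mathfrak p^{n_{\mathfrak p}}\mathcal O)_{\mathfrak p}\subseteq R_{\mathfrak p}$. Then there is a natural monoid isomorphism \[W_{\mathcal S}(R)\longleftrightarrow\prod_{\mathfrak p\in\mathcal S_0}W(R+\mathfrak p^{n_{\mathfrak p}}\mathcal O),\] which induces a bijection \[\bar W_{\mathcal S}(R)\longleftrightarrow\prod_{\mathfrak p\in\mathcal S_0}\bar W(R+\mathfrak p^{n_{\mathfrak p}}\mathcal O).\]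
   Context: Let $Z$ be a Dedekind domain (in particular not a field) with fraction field $Q$, and let $K$ be an étale $Q$-algebra. A $Z$-lattice in $K$ is a finitely generated $Z$-submodule of $K$ containing a $Q$-basis of $K$. An order is a subring of $K$ that is a $Z$-lattice; $\mathcal O$ is the maximal order of $K$. A fractional $R$-ideal is an $R$-submodule of $K$ that is a $Z$-lattice; $(I:J)=\{a\in K: aJ\subseteq I\}$. For a maximal ideal $\mathfrak p$ of an order $S$, $S_{\mathfrak p}$ is the completion at $\mathfrak p$ and $I_{\mathfrak p}=I\otimes_S S_{\mathfrak p}$. Fractional $S$-ideals $I,J$ are $\mathfrak p$-equivalent if $I_{\mathfrak p}\simeq J_{\mathfrak p}$ as $S_{\mathfrak p}$-modules; for a set $\mathcal S$ of maximal ideals they are $\mathcal S$-equivalent if $\mathfrak p$-equivalent for all $\mathfrak p\in\mathcal S$, and weakly equivalent if $\mathfrak q$-equivalent for all maximal ideals $\mathfrak q$. $W(S)$ is the set of weak equivalence classes of fractional $S$-ideals and $\bar W(S)$ the subset of classes of $I$ with $(I:I)=S$; $W_{\mathcal S}(S)$ is the set of $\mathcal S$-equivalence classes and $\bar W_{\mathcal S}(S)$ the subset of classes of $I$ with $(I:I)_{\mathfrak p}=S_{\mathfrak p}$ for all $\mathfrak p\in\mathcal S$. $W(S)$ and $W_{\mathcal S}(S)$ are commutative monoids under ideal multiplication. *)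

(* Defs.v *)
From HB Require Import structures.
From mathcomp Require Import all_boot all_order all_algebra all_field.
From mathcomp Require Import boolp classical_sets functions cardinality.

Set Implicit Arguments.
Unset Strict Implicit.
Unset Printing Implicit Defensive.

Import GRing.Theory.
Local Open Scope classical_set_scope.
Local Open Scope quotient_scope.
Local Open Scope ring_scope.

Section Ideals.
Variable A : comPzRingType.

Definition is_ideal (I : set A) : Prop :=
  [/\ I 0, forall x y, I x -> I y -> I (x + y) & forall a x, I x -> I (a * x)].

Definition is_prime_ideal (I : set A) : Prop :=
  [/\ is_ideal I, ~ I 1 & forall x y, I (x * y) -> I x \/ I y].

Definition is_maximal_ideal (I : set A) : Prop :=
  [/\ is_ideal I, ~ I 1 &
      forall J : set A, is_ideal J -> I `<=` J -> J = I \/ J = setT].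

Definition fg_ideal (I : set A) : Prop :=
  exists s : seq A,
    I = [set x | exists c : nat -> A, x = \sum_(i < size s) c i * s`_i].

(* The additive subgroup generated by the products x * y; it is the usual
   product when X and Y are ideals, or modules inside a common ring. *)
Definition mulset (X Y : set A) : set A :=
  [set z | exists s : seq (A * A),
     (forall u, u \in s -> X u.1 /\ Y u.2) /\ z = \sum_(u <- s) u.1 * u.2].

Fixpoint ideal_pow (I : set A) (n : nat) : set A :=
  if n is m.+1 then mulset I (ideal_pow I m) else setT.

Record max_ideal := MaxIdeal {
  max_ideal_set :> set A;
  max_idealP : is_maximal_ideal max_ideal_set }.

Lemma mulset_ind (X Y P : set A) : P 0 ->
  (forall x y, P x -> P y -> P (x + y)) ->
  (forall x y, X x -> Y y -> P (x * y)) -> mulset X Y `<=` P.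
Proof.
move=> P0 PD PM z [s [sP ->]]; rewrite big_seq; elim/big_ind: _ => //.
by move=> u /sP[]; apply: PM.
Qed.

Lemma mulset0 (X Y : set A) : mulset X Y 0.
Proof. by exists [::]; rewrite big_nil. Qed.

Lemma mulsetD (X Y : set A) x y :
  mulset X Y x -> mulset X Y y -> mulset X Y (x + y).
Proof.
move=> [s [sP ->]] [t [tP ->]]; exists (s ++ t); rewrite big_cat; split=> // u.
by rewrite mem_cat => /orP[/sP|/tP].
Qed.

Lemma mulsetM (X Y : set A) x y : X x -> Y y -> mulset X Y (x * y).
Proof.
move=> Xx Yy; exists [:: (x, y)]; rewrite big_seq1; split=> // u.
by rewrite inE => /eqP->.
Qed.

Lemma mulsetMl (X Y : set A) a : (forall x, X x -> X (a * x)) ->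
  forall z, mulset X Y z -> mulset X Y (a * z).
Proof.
move=> Xa; apply: mulset_ind => [|x y|x y Xx Yy].
- by rewrite mulr0; apply: mulset0.
- by rewrite mulrDr; apply: mulsetD.
- by rewrite mulrA; apply: mulsetM => //; apply: Xa.
Qed.

Lemma mulsetMr (X Y : set A) a : (forall y, Y y -> Y (a * y)) ->
  forall z, mulset X Y z -> mulset X Y (a * z).
Proof.
move=> Ya; apply: mulset_ind => [|x y|x y Xx Yy].
- by rewrite mulr0; apply: mulset0.
- by rewrite mulrDr; apply: mulsetD.
- by rewrite mulrCA; apply: mulsetM => //; apply: Ya.
Qed.

Lemma ideal_pow_ideal (I : set A) n : is_ideal I -> is_ideal (ideal_pow I n).
Proof.
case: n => [//|n] [_ _ IM]; split; first exact: mulset0.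
- by move=> x y; apply: mulsetD.
- by move=> a; apply: mulsetMl; apply: IM.
Qed.

Lemma ideal_oppr (I : set A) x : is_ideal I -> I x -> I (- x).
Proof. by case=> _ _ IM Ix; rewrite -mulN1r; apply: IM. Qed.

End Ideals.

Record dedekind_domain (Z : idomainType) : Prop := DedekindDomain {
  dedekind_noetherian : forall I : set Z, is_ideal I -> fg_ideal I;
  dedekind_int_closed : forall q : {fraction Z},
    integralOver (@tofrac Z) q -> exists z : Z, q = tofrac z;
  dedekind_dim1 : forall P : set Z,
    is_prime_ideal P -> P <> [set 0] -> is_maximal_ideal P;
  dedekind_not_field : exists z : Z, z != 0 /\ z \isn't a GRing.unit }.

Section Completion.
Variables (A : comPzRingType) (p : max_ideal A).

Definition coherent (x : nat -> A) : Prop :=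
  forall n, ideal_pow p n (x n.+1 - x n).

Record cohseq := CohSeq { cohval :> nat -> A; _ : `[< coherent cohval >] }.
HB.instance Definition _ := [isSub for cohval].
HB.instance Definition _ := [Choice of cohseq by <:].

Let pX n : is_ideal (ideal_pow p n).
Proof. by apply: ideal_pow_ideal; case: p => I []. Qed.
Let pXD n x y : ideal_pow p n x -> ideal_pow p n y -> ideal_pow p n (x + y).
Proof. by case: (pX n) => _ + _; apply. Qed.
Let pXM n a x : ideal_pow p n x -> ideal_pow p n (a * x).
Proof. by case: (pX n) => _ _; apply. Qed.
Let pXN n x : ideal_pow p n x -> ideal_pow p n (- x).
Proof. exact: ideal_oppr. Qed.
Let pX0 n : ideal_pow p n 0.
Proof. by case: (pX n). Qed.

Lemma cohseqP (x : cohseq) : coherent x.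
Proof. by case: x => x xP; apply/asboolP. Qed.

Definition mk_cohseq (x : nat -> A) (cx : coherent x) : cohseq :=
  CohSeq (asboolT cx).

Lemma coherent_cst a : coherent (fun=> a).
Proof. by move=> n; rewrite subrr; apply: pX0. Qed.

Lemma coherentD (x y : cohseq) : coherent (fun n => x n + y n).
Proof. by move=> n; rewrite opprD addrACA; apply: pXD; apply: cohseqP. Qed.

Lemma coherentN (x : cohseq) : coherent (fun n => - x n).
Proof. by move=> n; rewrite -opprD; apply/pXN/cohseqP. Qed.

Lemma coherentM (x y : cohseq) : coherent (fun n => x n * y n).
Proof.
move=> n; rewrite -[X in ideal_pow _ _ X](subrKA (x n * y n.+1)) -mulrBl -mulrBr.
by apply: pXD; last exact/pXM/cohseqP; rewrite mulrC; apply/pXM/cohseqP.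
Qed.

Definition coh_eqv (x y : cohseq) : bool :=
  `[< forall n, ideal_pow p n (x n - y n) >].

Lemma coh_eqv_refl : reflexive coh_eqv.
Proof. by move=> x; apply/asboolP => n; rewrite subrr; apply: pX0. Qed.
Lemma coh_eqv_sym : symmetric coh_eqv.
Proof.
suff H x y : coh_eqv x y -> coh_eqv y x by move=> x y; apply/idP/idP; apply: H.
by move=> /asboolP e; apply/asboolP => n; rewrite -opprB; apply/pXN/e.
Qed.
Lemma coh_eqv_trans : transitive coh_eqv.
Proof.
move=> y x z /asboolP e /asboolP f; apply/asboolP => n.
by rewrite -(subrKA (y n)); apply: pXD.
Qed.

Canonical coh_eqv_equiv :=
  EquivRel coh_eqv coh_eqv_refl coh_eqv_sym coh_eqv_trans.

(* The inverse limit of the quotients A / p^n: a compatible family of residue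
   classes is represented by a sequence of lifts. *)
Definition completion := {eq_quot coh_eqv}.
HB.instance Definition _ := Choice.on completion.

Definition compl_class (x : cohseq) : completion := \pi x.

Definition to_completion_def (a : A) : completion :=
  compl_class (mk_cohseq (coherent_cst a)).
Definition compl_add (x y : completion) : completion :=
  compl_class (mk_cohseq (@coherentD (repr x) (repr y))).
Definition compl_opp (x : completion) : completion :=
  compl_class (mk_cohseq (@coherentN (repr x))).
Definition compl_mul (x y : completion) : completion :=
  compl_class (mk_cohseq (@coherentM (repr x) (repr y))).

Lemma compl_eqP (x y : cohseq) :
  compl_class x = compl_class y <->
  forall n, ideal_pow p n (x n - y n).
Proof. by split=> [/eqmodP/asboolP|/asboolP e]; last exact/eqmodP. Qed.

Lemma compl_reprP (x : cohseq) n :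
  ideal_pow p n (repr (compl_class x) n - x n).
Proof. by move: n; apply/compl_eqP; rewrite /compl_class reprK. Qed.

Lemma compl_addE (x y : cohseq) : compl_add (compl_class x) (compl_class y) =
  compl_class (mk_cohseq (@coherentD x y)).
Proof.
apply/compl_eqP => n /=; rewrite opprD addrACA.
by apply: pXD; apply: compl_reprP.
Qed.

Lemma compl_oppE (x : cohseq) :
  compl_opp (compl_class x) = compl_class (mk_cohseq (@coherentN x)).
Proof. by apply/compl_eqP => n /=; rewrite -opprD; apply/pXN/compl_reprP. Qed.

Lemma compl_mulE (x y : cohseq) : compl_mul (compl_class x) (compl_class y) =
  compl_class (mk_cohseq (@coherentM x y)).
Proof.
apply/compl_eqP => n /=.
rewrite -(subrKA (x n * repr (compl_class y) n)) -mulrBl -mulrBr.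
by apply: pXD; last exact/pXM/compl_reprP; rewrite mulrC; apply/pXM/compl_reprP.
Qed.

Let compl_ext (x y : cohseq) : (forall n, x n = y n) ->
  compl_class x = compl_class y.
Proof. by move=> e; apply/compl_eqP => n; rewrite e subrr; apply: pX0. Qed.

Let complE := (compl_addE, compl_oppE, compl_mulE).

Let complW (P : completion -> Prop) :
  (forall x, P (compl_class x)) -> forall x, P x.
Proof. by move=> h x; elim/quotW: x => x; apply: h. Qed.

Lemma compl_addA : associative compl_add.
Proof.
move=> x y z; elim/complW: x => x; elim/complW: y => y; elim/complW: z => z.
by rewrite !complE; apply: compl_ext => n /=; rewrite addrA.
Qed.
Lemma compl_addC : commutative compl_add.
Proof.
move=> x y; elim/complW: x => x; elim/complW: y => y.
by rewrite !complE; apply: compl_ext => n /=; rewrite addrC.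
Qed.
Lemma compl_add0 : left_id (to_completion_def 0) compl_add.
Proof.
move=> x; elim/complW: x => x.
by rewrite !complE; apply: compl_ext => n /=; rewrite add0r.
Qed.
Lemma compl_addN : left_inverse (to_completion_def 0) compl_opp compl_add.
Proof.
move=> x; elim/complW: x => x.
by rewrite !complE; apply: compl_ext => n /=; rewrite addNr.
Qed.
Lemma compl_mulA : associative compl_mul.
Proof.
move=> x y z; elim/complW: x => x; elim/complW: y => y; elim/complW: z => z.
by rewrite !complE; apply: compl_ext => n /=; rewrite mulrA.
Qed.
Lemma compl_mulC : commutative compl_mul.
Proof.
move=> x y; elim/complW: x => x; elim/complW: y => y.
by rewrite !complE; apply: compl_ext => n /=; rewrite mulrC.
Qed.
Lemma compl_mul1 : left_id (to_completion_def 1) compl_mul.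
Proof.
move=> x; elim/complW: x => x.
by rewrite !complE; apply: compl_ext => n /=; rewrite mul1r.
Qed.
Lemma compl_mulD : left_distributive compl_mul compl_add.
Proof.
move=> x y z; elim/complW: x => x; elim/complW: y => y; elim/complW: z => z.
by rewrite !complE; apply: compl_ext => n /=; rewrite mulrDl.
Qed.

HB.instance Definition _ := GRing.isZmodule.Build completion
  compl_addA compl_addC compl_add0 compl_addN.
HB.instance Definition _ := GRing.Zmodule_isComPzRing.Build completion
  compl_mulA compl_mulC compl_mul1 compl_mulD.

Definition to_completion : A -> completion := to_completion_def.

Lemma to_completion_additive : zmod_morphism to_completion.
Proof.
move=> a b; rewrite /to_completion /to_completion_def.
rewrite [RHS]/GRing.add /= [X in compl_add _ X]/GRing.opp /= !complE.
by apply: compl_ext.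
Qed.
Lemma to_completion_multiplicative : monoid_morphism to_completion.
Proof.
split=> // a b; rewrite /to_completion /to_completion_def.
by rewrite [RHS]/GRing.mul /= !complE; apply: compl_ext.
Qed.
HB.instance Definition _ :=
  GRing.isZmodMorphism.Build A completion to_completion to_completion_additive.
HB.instance Definition _ :=
  GRing.isMonoidMorphism.Build A completion to_completion
    to_completion_multiplicative.

End Completion.

Section BaseChange.
Variables (A B : comPzRingType) (f : {rmorphism A -> B}) (M : lmodType A).

(* A list [:: (x1, b1); ...; (xk, bk)] stands for the formal sum of the
   x_i (x) b_i; tensor_rel is the congruence on formal sums generated by
   biadditivity and by (a *: x) (x) b = x (x) (f a * b). *)
Inductive tensor_rel : seq (M * B) -> seq (M * B) -> Prop :=
| Tensor_refl s : tensor_rel s s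
| Tensor_sym s t : tensor_rel s t -> tensor_rel t s
| Tensor_trans s t u : tensor_rel s t -> tensor_rel t u -> tensor_rel s u
| Tensor_cat s s' t t' :
    tensor_rel s s' -> tensor_rel t t' -> tensor_rel (s ++ t) (s' ++ t')
| Tensor_catC s t : tensor_rel (s ++ t) (t ++ s)
| Tensor_addl x y b : tensor_rel [:: (x + y, b)] [:: (x, b); (y, b)]
| Tensor_addr x b c : tensor_rel [:: (x, b + c)] [:: (x, b); (x, c)]
| Tensor_scale a x b : tensor_rel [:: (a *: x, b)] [:: (x, f a * b)]
| Tensor_zero b : tensor_rel [:: (0, b)] [::].

Definition tensor_eqv (s t : seq (M * B)) : bool := `[< tensor_rel s t >].

Lemma tensor_eqv_refl : reflexive tensor_eqv.
Proof. by move=> s; apply/asboolP; apply: Tensor_refl. Qed.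
Lemma tensor_eqv_sym : symmetric tensor_eqv.
Proof. by move=> s t; apply/asboolP/asboolP; apply: Tensor_sym. Qed.
Lemma tensor_eqv_trans : transitive tensor_eqv.
Proof.
by move=> t s u /asboolP st /asboolP tu; apply/asboolP; apply: Tensor_trans tu.
Qed.

Canonical tensor_eqv_equiv :=
  EquivRel tensor_eqv tensor_eqv_refl tensor_eqv_sym tensor_eqv_trans.

(* The tensor product of M and B over A, as a B-module. *)
Definition base_change := {eq_quot tensor_eqv}.
HB.instance Definition _ := Choice.on base_change.

Definition bc_class (s : seq (M * B)) : base_change := \pi s.

Definition bc_opp_seq (s : seq (M * B)) := [seq (- u.1, u.2) | u <- s].
Definition bc_scale_seq (c : B) (s : seq (M * B)) :=
  [seq (u.1, c * u.2) | u <- s].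

Definition bc_add (x y : base_change) := bc_class (repr x ++ repr y).
Definition bc_opp (x : base_change) := bc_class (bc_opp_seq (repr x)).
Definition bc_scale (c : B) (x : base_change) :=
  bc_class (bc_scale_seq c (repr x)).

Lemma bc_classP s t : bc_class s = bc_class t <-> tensor_rel s t.
Proof. by split=> [/eqmodP/asboolP|/asboolP e]; last exact/eqmodP. Qed.

Lemma bc_reprP s : tensor_rel (repr (bc_class s)) s.
Proof. by apply/bc_classP; rewrite /bc_class reprK. Qed.

Lemma bc_opp_rel s t :
  tensor_rel s t -> tensor_rel (bc_opp_seq s) (bc_opp_seq t).
Proof.
elim=> {s t} [s|s t _|s t u _ ih1 _ ih2|s s' t t' _ ih1 _ ih2|s t|x y b|x b c|a x b|b].
- exact: Tensor_refl.
- exact: Tensor_sym.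
- exact: Tensor_trans ih1 ih2.
- by rewrite /bc_opp_seq !map_cat; apply: Tensor_cat.
- by rewrite /bc_opp_seq !map_cat; apply: Tensor_catC.
- by rewrite /= opprD; apply: Tensor_addl.
- exact: Tensor_addr.
- by rewrite /= -scalerN; apply: Tensor_scale.
- by rewrite /= oppr0; apply: Tensor_zero.
Qed.

Lemma bc_scale_rel d s t :
  tensor_rel s t -> tensor_rel (bc_scale_seq d s) (bc_scale_seq d t).
Proof.
elim=> {s t} [s|s t _|s t u _ ih1 _ ih2|s s' t t' _ ih1 _ ih2|s t|x y b|x b c|a x b|b].
- exact: Tensor_refl.
- exact: Tensor_sym.
- exact: Tensor_trans ih1 ih2.
- by rewrite /bc_scale_seq !map_cat; apply: Tensor_cat.
- by rewrite /bc_scale_seq !map_cat; apply: Tensor_catC.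
- exact: Tensor_addl.
- by rewrite /= mulrDr; apply: Tensor_addr.
- by rewrite /= mulrCA; apply: Tensor_scale.
- exact: Tensor_zero.
Qed.

Lemma bc_addE s t : bc_add (bc_class s) (bc_class t) = bc_class (s ++ t).
Proof. by apply/bc_classP/Tensor_cat; apply: bc_reprP. Qed.
Lemma bc_oppE s : bc_opp (bc_class s) = bc_class (bc_opp_seq s).
Proof. by apply/bc_classP/bc_opp_rel/bc_reprP. Qed.
Lemma bc_scaleE c s : bc_scale c (bc_class s) = bc_class (bc_scale_seq c s).
Proof. by apply/bc_classP/bc_scale_rel/bc_reprP. Qed.

Let bcW (P : base_change -> Prop) : (forall s, P (bc_class s)) -> forall x, P x.
Proof. by move=> h x; elim/quotW: x => s; apply: h. Qed.

Lemma bc_addA : associative bc_add.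
Proof.
by elim/bcW=> s; elim/bcW=> t; elim/bcW=> u; rewrite !bc_addE catA.
Qed.
Lemma bc_addC : commutative bc_add.
Proof.
by elim/bcW=> s; elim/bcW=> t; rewrite !bc_addE; apply/bc_classP/Tensor_catC.
Qed.
Lemma bc_add0 : left_id (bc_class [::]) bc_add.
Proof. by elim/bcW=> s; rewrite bc_addE. Qed.
Lemma bc_addN : left_inverse (bc_class [::]) bc_opp bc_add.
Proof.
elim/bcW=> s; rewrite bc_oppE; elim: s => [|[x b] s ih]; first by rewrite bc_addE.
rewrite -(cat1s _ s) /bc_opp_seq map_cat -!bc_addE.
rewrite (bc_addC (bc_class [:: (x, b)])) -bc_addA (bc_addA _ _ (bc_class [:: _])).
rewrite ih bc_add0 bc_addE; apply/bc_classP.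
apply: Tensor_trans (Tensor_zero b); apply: Tensor_sym.
by rewrite -(addNr x); apply: Tensor_addl.
Qed.
HB.instance Definition _ := GRing.isZmodule.Build base_change
  bc_addA bc_addC bc_add0 bc_addN.

Lemma bc_scaleA a b x : bc_scale a (bc_scale b x) = bc_scale (a * b) x.
Proof.
elim/bcW: x => s; rewrite !bc_scaleE /bc_scale_seq -map_comp.
by congr bc_class; apply: eq_map => u /=; rewrite mulrA.
Qed.
Lemma bc_scale1 : left_id 1 bc_scale.
Proof.
elim/bcW=> s; rewrite bc_scaleE /bc_scale_seq; congr bc_class.
by rewrite -[RHS]map_id; apply: eq_map => -[x b] /=; rewrite mul1r.
Qed.
Lemma bc_scaleDr : right_distributive bc_scale +%R.
Proof.
move=> c; elim/bcW=> s; elim/bcW=> t.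
by rewrite /GRing.add /= bc_addE !bc_scaleE bc_addE /bc_scale_seq map_cat.
Qed.
Lemma bc_scaleDl x : {morph bc_scale^~ x : a b / a + b}.
Proof.
move=> a b; elim/bcW: x => s /=; rewrite !bc_scaleE.
rewrite [RHS]/GRing.add /=; elim: s => [|[x c] s ih]; first by rewrite bc_addE.
have cons y t : bc_class (y :: t) = bc_add (bc_class [:: y]) (bc_class t).
  by rewrite bc_addE.
rewrite /= [LHS]cons ih [X in _ = bc_add X _]cons [X in _ = bc_add _ X]cons.
have ACA : interchange bc_add bc_add.
  by move=> u v w z; rewrite -!bc_addA; congr bc_add; rewrite !bc_addA (bc_addC v).
rewrite [RHS]ACA; congr bc_add.
by rewrite bc_addE mulrDl; apply/bc_classP/Tensor_addr.
Qed.
HB.instance Definition _ := GRing.Zmodule_isLmodule.Build B base_change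
  bc_scaleA bc_scale1 bc_scaleDr bc_scaleDl.

End BaseChange.

(* A finite product of finite separable field extensions of Q: the morphisms
   phi i are the projections of such a decomposition. *)
Definition etale_algebra (Q : fieldType) (K : comAlgType Q) : Prop :=
  exists (k : nat) (L : 'I_k -> fieldExtType Q)
         (phi : forall i, {lrmorphism K -> L i}),
    (forall i, separable 1%AS {:L i}%AS) /\
    (forall y : (forall i, L i), exists! x : K, forall i, phi i x = y i).

Section Lattices.
Variables (Z : idomainType) (K : comAlgType {fraction Z}).
Implicit Types (X Y M : set K) (s t : seq K).

Definition Zscale (a : Z) (x : K) : K := tofrac a *: x.

Definition Zspan s : set K :=
  [set x | exists c : nat -> Z, x = \sum_(i < size s) Zscale (c i) s`_i].

Definition is_Qbasis (k : nat) (b : 'I_k -> K) : Prop :=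
  forall x, exists! c : {ffun 'I_k -> {fraction Z}}, x = \sum_i c i *: b i.

Definition is_lattice X : Prop :=
  (exists s, X = Zspan s) /\
  (exists (k : nat) (b : 'I_k -> K), is_Qbasis b /\ forall i, X (b i)).

Definition is_Zsubmodule M : Prop :=
  [/\ M 0, forall x y, M x -> M y -> M (x + y)
         & forall a x, M x -> M (Zscale a x)].

Definition setadd X Y : set K :=
  [set z | exists x y, [/\ X x, Y y & z = x + y]].

Lemma Zscale0r a : Zscale a 0 = 0. Proof. exact: scaler0. Qed.
Lemma Zscale0l x : Zscale 0 x = 0.
Proof. by rewrite /Zscale rmorph0 scale0r. Qed.
Lemma Zscale1 x : Zscale 1 x = x.
Proof. by rewrite /Zscale rmorph1 scale1r. Qed.
Lemma ZscaleDr a x y : Zscale a (x + y) = Zscale a x + Zscale a y.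
Proof. exact: scalerDr. Qed.
Lemma ZscaleDl a b x : Zscale (a + b) x = Zscale a x + Zscale b x.
Proof. by rewrite /Zscale rmorphD scalerDl. Qed.
Lemma ZscaleA a b x : Zscale a (Zscale b x) = Zscale (a * b) x.
Proof. by rewrite /Zscale scalerA rmorphM. Qed.
Lemma ZscaleN1 x : Zscale (- 1) x = - x.
Proof. by rewrite /Zscale rmorphN1 scaleN1r. Qed.

Lemma Zsubmodule_opp M x : is_Zsubmodule M -> M x -> M (- x).
Proof. by case=> _ _ MZ Mx; rewrite -ZscaleN1; apply: MZ. Qed.

Lemma Zsubmodule_sum M k (F : 'I_k -> K) : is_Zsubmodule M ->
  (forall i, M (F i)) -> M (\sum_(i < k) F i).
Proof. by case=> M0 MD _ MF; elim/big_ind: _. Qed.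

Lemma Zspan_nil : Zspan [::] = [set 0].
Proof.
apply/seteqP; split=> x /=; first by case=> c ->; rewrite big_ord0.
by move=> ->; exists (fun=> 0); rewrite big_ord0.
Qed.

Lemma Zspan_consP y s x :
  Zspan (y :: s) x <-> exists a z, Zspan s z /\ x = Zscale a y + z.
Proof.
split=> [[c ->]|[a [z [[c ->] ->]]]].
  exists (c 0%N), (\sum_(i < size s) Zscale (c i.+1) s`_i).
  by split; [exists (fun i => c i.+1) | rewrite /= big_ord_recl].
exists (fun i => if i is j.+1 then c j else a).
by rewrite /= big_ord_recl.
Qed.

Lemma Zspan_submodule s : is_Zsubmodule (Zspan s).
Proof.
split.
- by exists (fun=> 0); rewrite big1 // => i _; apply: Zscale0l.
- move=> x y [c ->] [d ->]; exists (fun i => c i + d i).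
  by rewrite -big_split; apply: eq_bigr => i _; rewrite ZscaleDl.
- move=> a x [c ->]; exists (fun i => a * c i).
  rewrite /Zscale scaler_sumr; apply: eq_bigr => i _.
  exact: ZscaleA.
Qed.

Lemma Zspan_min M s : is_Zsubmodule M -> (forall x, x \in s -> M x) ->
  Zspan s `<=` M.
Proof.
move=> Mmod sM x [c ->]; apply: Zsubmodule_sum => // i.
by case: Mmod => _ _; apply; apply/sM/mem_nth.
Qed.

Lemma Zspan_mem s x : x \in s -> Zspan s x.
Proof.
elim: s => // y s ih; rewrite inE => /orP[/eqP->|/ih xs]; apply/Zspan_consP.
  exists 1, 0; rewrite Zscale1 addr0; split=> //.
  by case: (Zspan_submodule s).
by exists 0, x; rewrite Zscale0l add0r.
Qed.

Lemma is_lattice_submodule X : is_lattice X -> is_Zsubmodule X.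
Proof. by case=> [[s ->] _]; apply: Zspan_submodule. Qed.

Lemma Zspan_cat s t : Zspan (s ++ t) = setadd (Zspan s) (Zspan t).
Proof.
have sm := Zspan_submodule; apply/seteqP; split.
  apply: Zspan_min; first split.
  - by exists 0, 0; rewrite addr0; split=> //; case: (sm s); case: (sm t).
  - move=> _ _ [x [y [xs yt ->]]] [x' [y' [xs' yt' ->]]].
    exists (x + x'), (y + y'); rewrite addrACA.
    by split=> //; [case: (sm s)|case: (sm t)] => _ + _; apply.
  - move=> a _ [x [y [xs yt ->]]]; exists (Zscale a x), (Zscale a y).
    by rewrite ZscaleDr; split=> //; [case: (sm s)|case: (sm t)] => _ _; apply.
  move=> x; rewrite mem_cat => /orP[] /Zspan_mem xs.
    by exists x, 0; rewrite addr0; split=> //; case: (sm t).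
  by exists 0, x; rewrite add0r; split=> //; case: (sm s).
move=> _ [x [y [xs yt ->]]]; case: (sm (s ++ t)) => _ stD _; apply: stD.
  by apply: (Zspan_min (sm _) _ xs) => z zs; apply: Zspan_mem; rewrite mem_cat zs.
apply: (Zspan_min (sm _) _ yt) => z zt.
by apply: Zspan_mem; rewrite mem_cat zt orbT.
Qed.

Lemma Zspan_noetherian M s : dedekind_domain Z ->
  is_Zsubmodule M -> M `<=` Zspan s -> exists t, M = Zspan t.
Proof.
move=> dedZ; elim: s M => [|y s ih] M Mmod Ms.
  exists [::]; apply/seteqP; split=> // x; rewrite Zspan_nil => ->.
  by case: Mmod.
have [M0 MD MZ] := Mmod; have [s0 sD sZ] := Zspan_submodule s.
pose I : set Z := [set a | exists z, Zspan s z /\ M (Zscale a y + z)].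
have Iideal : is_ideal I.
  split.
  - by exists 0; rewrite Zscale0l addr0.
  - move=> a b [u [us Mu]] [v [vs Mv]]; exists (u + v).
    by rewrite ZscaleDl addrACA; split; [apply: sD | apply: MD].
  - move=> a b [u [us Mu]]; exists (Zscale a u).
    by rewrite -ZscaleA -ZscaleDr; split; [apply: sZ | apply: MZ].
have [l Il] := dedekind_noetherian dedZ Iideal.
have /choice[g gP] (a : Z) : exists z, I a -> Zspan s z /\ M (Zscale a y + z).
  by have [[z zP]|nIa] := pselect (I a); [exists z | exists 0].
pose h a := Zscale a y + g a.
have lI a : a \in l -> I a.
  move=> al; rewrite Il; exists (fun i => (i == index a l)%:R).
  have al' : (index a l < size l)%N by rewrite index_mem.
  rewrite (bigD1 (Ordinal al')) //= eqxx mul1r nth_index // big1 ?addr0 //.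
  by move=> i /negPf ni; rewrite -[_ == _]/(i == Ordinal al') ni mul0r.
have M'mod : is_Zsubmodule (M `&` Zspan s).
  split=> //; first by move=> u v [Mu su] [Mv sv]; split; [apply: MD|apply: sD].
  by move=> a u [Mu su]; split; [apply: MZ|apply: sZ].
have [t Mt] := ih _ M'mod (fun _ => @proj2 _ _).
exists (map h l ++ t); apply/seteqP; split=> [x Mx|]; last first.
  apply: Zspan_min => // x; rewrite mem_cat => /orP[/mapP[a al ->]|xt].
    by case: (gP a (lI a al)).
  by have : (M `&` Zspan s) x; [rewrite Mt; apply: Zspan_mem | case].
rewrite Zspan_cat.
have /Zspan_consP[a [z [sz xE]]] := Ms x Mx.
have : I a by exists z; rewrite -xE.
rewrite Il => -[c aE].
pose w := \sum_(i < size l) Zscale (c i) (h l`_i).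
have hw : Zspan (map h l) w.
  exists c; rewrite size_map; apply: eq_bigr => i _.
  by rewrite (nth_map 0).
have Mw : M w.
  apply: (Zsubmodule_sum Mmod) => i; apply: MZ.
  by case: (gP l`_i) => //; apply/lI/mem_nth.
exists w, (x - w); split=> //; last by rewrite addrC subrK.
rewrite -Mt; split; first by apply: MD => //; apply: (Zsubmodule_opp Mmod).
rewrite xE; have -> : w = Zscale a y + \sum_(i < size l) Zscale (c i) (g l`_i).
  rewrite aE /Zscale rmorph_sum scaler_suml -big_split; apply: eq_bigr => i _.
  by rewrite /h ZscaleDr ZscaleA.
rewrite opprD addrACA subrr add0r; apply: sD => //.
apply: (Zsubmodule_opp (Zspan_submodule s)).
apply: (Zsubmodule_sum (Zspan_submodule s)) => i; apply: sZ.
by case: (gP l`_i) => //; apply/lI/mem_nth.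
Qed.

Lemma mulset_Zspan s t :
  mulset (Zspan s) (Zspan t) = Zspan [seq x * y | x <- s, y <- t].
Proof.
set u := [seq x * y | x <- s, y <- t]; have umod := Zspan_submodule u.
have [u0 uD uZ] := umod; apply/seteqP; split.
  apply: mulset_ind => // x y xs yt; move: x xs; apply: Zspan_min; first split.
  - by rewrite mul0r.
  - by move=> x x' xy x'y; rewrite mulrDl; apply: uD.
  - by move=> a x xy; rewrite /Zscale -scalerAl; apply: uZ.
  move=> x xs; move: y yt; apply: Zspan_min; first split.
  - by rewrite mulr0.
  - by move=> y y' xy x'y; rewrite mulrDr; apply: uD.
  - by move=> a y xy; rewrite /Zscale -scalerAr; apply: uZ.
  by move=> y yt; apply/Zspan_mem/allpairsP; exists (x, y).
apply: Zspan_min => [|_ /allpairsP[[x y] /= [xs yt ->]]]; last first.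
  by apply: mulsetM; apply: Zspan_mem.
split; [exact: mulset0 | exact: mulsetD|].
move=> a x xst; rewrite /Zscale -[x]mul1r scalerAl.
apply: mulsetMl xst => y ys.
by rewrite -scalerAl mul1r; case: (Zspan_submodule s) => _ _; apply.
Qed.

Lemma frac_denom (q : {fraction Z}) :
  exists d n : Z, d != 0 /\ tofrac d * q = tofrac n.
Proof.
elim/quotW: q => x; exists \d_x, \n_x; split; first exact: denom_ratioP.
rewrite -[LHS]/(FracField.mul _ _) !piE; apply/eqmodP; rewrite /= FracField.equivfE.
by rewrite !numden_Ratio ?(oner_eq0, mulf_neq0, denom_ratioP) // !mulr1 !mul1r.
Qed.

Lemma frac_common_denom k (c : 'I_k -> {fraction Z}) :
  exists (d : Z) (n : 'I_k -> Z),
    d != 0 /\ forall i, tofrac d * c i = tofrac (n i).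
Proof.
have /choice[e eP] i : exists e : Z * Z,
    e.1 != 0 /\ tofrac e.1 * c i = tofrac e.2.
  by have [d [n [dn0 dn]]] := frac_denom (c i); exists (d, n).
exists (\prod_i (e i).1), (fun i => (\prod_(j < k | j != i) (e j).1) * (e i).2).
split=> [|i]; first by apply/prodf_neq0 => i _; case: (eP i).
rewrite (bigD1 i) //= !tofracM -mulrA [tofrac (\prod_(_ < _ | _) _) * c i]mulrC.
by rewrite mulrA (proj2 (eP i)) mulrC.
Qed.

Lemma is_lattice1 X : is_lattice X -> exists d : Z, d != 0 /\ X (Zscale d 1).
Proof.
move=> latX; have Xmod := is_lattice_submodule latX.
case: latX => _ [k [b [bbasis bX]]]; have [c [c1 _]] := bbasis 1.
have [d [n [d0 dn]]] := frac_common_denom c; exists d; split=> //.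
rewrite c1 /Zscale scaler_sumr; apply: (Zsubmodule_sum Xmod) => i.
by rewrite scalerA dn; case: Xmod => _ _; apply.
Qed.

Lemma is_lattice_mul X Y : is_lattice X -> is_lattice Y -> is_lattice (mulset X Y).
Proof.
move=> latX latY; split.
  case: latX latY => [[s ->] _] [[t ->] _].
  by exists [seq x * y | x <- s, y <- t]; apply: mulset_Zspan.
have [d [d0 Xd]] := is_lattice1 latX; have [_ [k [b [bbasis bY]]]] := latY.
have fd0 : tofrac d != 0 by rewrite tofrac_eq0.
exists k, (fun i => Zscale d (b i)); split=> [x|i]; last first.
  by rewrite /Zscale -[b i]mul1r scalerAl; apply: mulsetM.
have [c [cx cU]] := bbasis x.
exists [ffun i => c i / tofrac d]; split=> [|c' c'x].
  rewrite cx; apply: eq_bigr => i _.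
  by rewrite ffunE /Zscale scalerA mulfVK.
have cE : c = [ffun i => c' i * tofrac d].
  by apply: cU; rewrite c'x; apply: eq_bigr => i _; rewrite ffunE scalerA.
by apply/ffunP => i; rewrite cE !ffunE mulfK.
Qed.

End Lattices.

Section Orders.
Variables (Z : idomainType) (K : comAlgType {fraction Z}).

Record Zorder := ZOrder {
  Zorder_set :> set K;
  Zorder_subring : [/\ Zorder_set 1,
    forall x y, Zorder_set x -> Zorder_set y -> Zorder_set (x - y) &
    forall x y, Zorder_set x -> Zorder_set y -> Zorder_set (x * y)];
  Zorder_lattice : is_lattice Zorder_set }.

Definition is_maximal_order (O : Zorder) : Prop :=
  forall S : Zorder, S `<=` O.

Definition Zorder_pred (S : Zorder) : {pred K} := fun x => x \in (S : set K).

Lemma Zorder_pred_subring S : GRing.subring_closed (Zorder_pred S).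
Proof.
case: (Zorder_subring S) => S1 SB SM; split; rewrite /Zorder_pred.
- exact/mem_set.
- by move=> x y /set_mem Sx /set_mem Sy; apply/mem_set/SB.
- by move=> x y /set_mem Sx /set_mem Sy; apply/mem_set/SM.
Qed.
HB.instance Definition _ S :=
  GRing.isSubringClosed.Build K (Zorder_pred S) (Zorder_pred_subring S).

Record order_ring (S : Zorder) :=
  OrderRing { order_val : K; _ : order_val \in Zorder_pred S }.
HB.instance Definition _ S := [isSub for @order_val S].
HB.instance Definition _ S := [Choice of order_ring S by <:].
HB.instance Definition _ S :=
  [SubChoice_isSubComNzRing of order_ring S by <:].

End Orders.

(* K viewed as a module over S; the argument S selects the module structure. *)
Definition ambient_type (Z : idomainType) (K : comAlgType {fraction Z})
  (S : Zorder K) : Type := K.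

Section FractionalIdeals.
Variables (Z : idomainType) (K : comAlgType {fraction Z}) (S : Zorder K).

Lemma order_valP (a : order_ring S) : Zorder_set S (val a).
Proof. exact/set_mem/(valP a). Qed.

HB.instance Definition _ := GRing.Zmodule.copy (ambient_type S) K.

Definition ambient_scale (a : order_ring S) (x : ambient_type S) :
  ambient_type S := val a * (x : K).

Lemma ambient_scaleA a b x :
  ambient_scale a (ambient_scale b x) = ambient_scale (a * b) x.
Proof. exact: mulrA. Qed.
Lemma ambient_scale1 : left_id 1 ambient_scale.
Proof. exact: mul1r. Qed.
Lemma ambient_scaleDr : right_distributive ambient_scale +%R.
Proof. by move=> a x y; apply: mulrDr. Qed.
Lemma ambient_scaleDl x : {morph ambient_scale^~ x : a b / a + b}.
Proof. by move=> a b; apply: mulrDl. Qed.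
HB.instance Definition _ := GRing.Zmodule_isLmodule.Build (order_ring S)
  (ambient_type S) ambient_scaleA ambient_scale1 ambient_scaleDr ambient_scaleDl.

Record frac_ideal := FracIdeal {
  fi_set :> set K;
  fi_scale : forall a x, Zorder_set S a -> fi_set x -> fi_set (a * x);
  fi_lattice : is_lattice fi_set }.
HB.instance Definition _ := gen_eqMixin frac_ideal.
HB.instance Definition _ := gen_choiceMixin frac_ideal.

Definition fi_pred (I : frac_ideal) : {pred ambient_type S} :=
  fun x => x \in (I : set K).

Lemma fi_pred_submod I : GRing.submod_closed (fi_pred I).
Proof.
have [I0 ID _] := is_lattice_submodule (fi_lattice I).
split=> [|a x y /set_mem Ix /set_mem Iy]; first exact: mem_set.
by apply/mem_set/ID => //; apply: fi_scale => //; apply: order_valP.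
Qed.
HB.instance Definition _ I := GRing.isSubmodClosed.Build (order_ring S)
  (ambient_type S) (fi_pred I) (fi_pred_submod I).

Record fi_module (I : frac_ideal) :=
  FiModule { fi_val : ambient_type S; _ : fi_val \in fi_pred I }.
HB.instance Definition _ I := [isSub for @fi_val I].
HB.instance Definition _ I := [Choice of fi_module I by <:].
HB.instance Definition _ I := [SubChoice_isSubLmodule of fi_module I by <:].

Lemma fi_one_scale a x : Zorder_set S a -> Zorder_set S x -> Zorder_set S (a * x).
Proof. by case: (Zorder_subring S) => _ _; apply. Qed.
Definition fi_one : frac_ideal := FracIdeal fi_one_scale (Zorder_lattice S).

Lemma fi_mul_scale (I J : frac_ideal) a x :
  Zorder_set S a -> mulset I J x -> mulset I J (a * x).
Proof. by move=> Sa; apply: mulsetMl => y; apply: fi_scale. Qed.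
Definition fi_mul (I J : frac_ideal) : frac_ideal :=
  FracIdeal (@fi_mul_scale I J)
    (is_lattice_mul (fi_lattice I) (fi_lattice J)).

Definition colon (X Y : set K) : set K :=
  [set a | forall x, Y x -> X (a * x)].

Definition fi_completion (p : max_ideal (order_ring S)) (I : frac_ideal) :=
  base_change (to_completion p) (fi_module I).

(* For a subset X of K, the image in K (x)_S S_p of X (x) S_p; for a
   fractional ideal this is I_p viewed inside the completion of K. *)
Definition local_span (p : max_ideal (order_ring S)) (X : set K) :
    set (base_change (to_completion p) (ambient_type S)) :=
  [set bc_class (to_completion p) s | s in
     [set s : seq (ambient_type S * completion p) |
        forall u, u \in s -> X u.1]].
Arguments local_span p X : clear implicits.

Definition p_equivalent (p : max_ideal (order_ring S)) (I J : frac_ideal) :=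
  exists g : {linear fi_completion p I -> fi_completion p J}, bijective g.

Definition set_equivalent (SS : set (max_ideal (order_ring S)))
    (I J : frac_ideal) : Prop :=
  forall p, SS p -> p_equivalent p I J.

Section Classes.
Variable SS : set (max_ideal (order_ring S)).

Definition set_eqv (I J : frac_ideal) : bool := `[< set_equivalent SS I J >].

Lemma set_eqv_refl : reflexive set_eqv.
Proof. by move=> I; apply/asboolP => p _; exists idfun; exists idfun. Qed.
Lemma set_eqv_sym : symmetric set_eqv.
Proof.
suff H I J : set_eqv I J -> set_eqv J I by move=> I J; apply/idP/idP; apply: H.
move=> /asboolP e; apply/asboolP => p /e[g [h gK hK]].
have hlin : linear h by apply: can2_linear gK hK.
pose hL := GRing.isLinear.Build _ _ _ _ h hlin.
by exists (HB.pack h hL : {linear _ -> _}); exists g.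
Qed.
Lemma set_eqv_trans : transitive set_eqv.
Proof.
move=> J I L /asboolP e /asboolP f; apply/asboolP => p Sp.
have [g gbij] := e p Sp; have [h hbij] := f p Sp.
by exists (h \o g : {linear _ -> _}); apply: bij_comp.
Qed.

Canonical set_eqv_equiv := EquivRel set_eqv set_eqv_refl set_eqv_sym set_eqv_trans.

Definition ideal_classes := {eq_quot set_eqv}.
HB.instance Definition _ := Choice.on ideal_classes.

Definition ideal_class (I : frac_ideal) : ideal_classes := \pi I.
Arguments ideal_class I : clear implicits.

Definition class_one : ideal_classes := ideal_class fi_one.

Definition class_mul (x y : ideal_classes) : ideal_classes :=
  ideal_class (fi_mul (repr x) (repr y)).

(* class_mul is defined through representatives; this says that it is the
   operation induced on classes by the multiplication of ideals. *)
Definition class_mul_induced : Prop := forall I J : frac_ideal,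
  class_mul (ideal_class I) (ideal_class J) = ideal_class (fi_mul I J).

Definition local_multiplicator_classes : set ideal_classes :=
  [set ideal_class I | I in
     [set I : frac_ideal | forall p, SS p -> local_span p (colon I I) = local_span p S]].

End Classes.

Definition weak_classes := ideal_classes setT.

Definition weak_multiplicator_classes : set weak_classes :=
  [set @ideal_class setT I | I in [set I : frac_ideal | colon I I = S]].

End FractionalIdeals.

Arguments local_span {Z K S} p X.
Arguments ideal_class {Z K S} SS I.
Arguments class_one {Z K S} SS.
Arguments class_mul {Z K S} SS x y.
Arguments class_mul_induced {Z K S} SS.
Arguments local_multiplicator_classes {Z K S} SS.
Arguments weak_multiplicator_classes {Z K} S.
Arguments weak_classes {Z K} S.

Section SumOrder.
Variables (Z : idomainType) (dedZ : dedekind_domain Z).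
Variables (K : comAlgType {fraction Z}) (R O : Zorder K).
Variables (p : max_ideal (order_ring R)) (n : nat).

Definition pow_ext : set K := mulset (val @` ideal_pow p n) O.

Lemma pow_ext_submodule : is_Zsubmodule pow_ext.
Proof.
split; [exact: mulset0|exact: mulsetD|].
move=> a x xP; rewrite /Zscale -[x]mul1r scalerAl; apply: mulsetMr xP => y Oy.
rewrite -scalerAl mul1r.
by case: (is_lattice_submodule (Zorder_lattice O)) => _ _; apply.
Qed.

Lemma sum_order_subring : let S := setadd R pow_ext in
  [/\ S 1, forall x y, S x -> S y -> S (x - y) &
      forall x y, S x -> S y -> S (x * y)].
Proof.
have [R1 RB RM] := Zorder_subring R; have [O1 OB OM] := Zorder_subring O.
have [P0 PD _] := pow_ext_submodule.
have pid : is_ideal (ideal_pow p n).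
  by apply: ideal_pow_ideal; case: (max_idealP p).
have RP a x : Zorder_set R a -> pow_ext x -> pow_ext (a * x).
  move=> Ra; apply: mulsetMl => _ [b pb <-].
  have Ra' : a \in Zorder_pred R by apply/mem_set.
  by exists (OrderRing Ra' * b) => //; case: pid => _ _; apply.
have OP a x : Zorder_set O a -> pow_ext x -> pow_ext (a * x).
  by move=> Oa; apply: mulsetMr => y; apply: OM.
have PP x y : pow_ext x -> pow_ext y -> pow_ext (x * y).
  move=> Px Py; move: x Px; apply: mulset_ind => [|x x' xy x'y|_ x [b pb <-] Ox].
  - by rewrite mul0r.
  - by rewrite mulrDl; apply: PD.
  - by rewrite -mulrA; apply: RP; [apply: order_valP | apply: OP].
move=> S; split.
- by exists 1, 0; rewrite addr0.
- move=> _ _ [a [x [Ra Px ->]]] [b [y [Rb Py ->]]].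
  exists (a - b), (x - y); rewrite opprD addrACA; split=> //; first exact: RB.
  by apply: PD => //; apply: (Zsubmodule_opp pow_ext_submodule).
- move=> _ _ [a [x [Ra Px ->]]] [b [y [Rb Py ->]]].
  exists (a * b), (a * y + b * x + x * y); split; first exact: RM.
    by apply: (PD); [apply: PD; apply: RP | apply: PP].
  by rewrite mulrDl !mulrDr [x * b]mulrC !addrA.
Qed.

Lemma sum_order_lattice : is_lattice (setadd R pow_ext).
Proof.
have [[s Rs] [k [b [bbasis bR]]]] := Zorder_lattice R; split; last first.
  exists k, b; split=> // i; exists (b i), 0; rewrite addr0; split=> //.
  exact: mulset0.
have [t RO] := proj1 (is_lattice_mul (Zorder_lattice R) (Zorder_lattice O)).
have [|u Pu] := Zspan_noetherian (s := t) dedZ pow_ext_submodule.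
  rewrite -RO; apply: mulset_ind; [exact: mulset0 | exact: mulsetD |].
  by move=> _ y [a _ <-] Oy; apply: mulsetM => //; apply: order_valP.
by exists (s ++ u); rewrite Zspan_cat -Rs -Pu.
Qed.

Definition sum_order : Zorder K := ZOrder sum_order_subring sum_order_lattice.

End SumOrder.

Arguments pow_ext {Z K R} O p n.
Arguments sum_order {Z} dedZ {K R} O p n.

Section Extension.
Variables (Z : idomainType) (K : comAlgType {fraction Z}) (R T : Zorder K).

Lemma fi_ext_scale (I : frac_ideal R) a x :
  Zorder_set T a -> mulset I T x -> mulset I T (a * x).
Proof. by move=> Ta; apply: mulsetMr => y; apply: fi_one_scale. Qed.

Definition fi_ext (I : frac_ideal R) : frac_ideal T :=
  FracIdeal (@fi_ext_scale I)
    (is_lattice_mul (fi_lattice I) (Zorder_lattice T)).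

End Extension.

Arguments fi_ext {Z K R} T I.

(* Main.v *)
Require Import Defs.
From HB Require Import structures.
From mathcomp Require Import all_boot all_order all_algebra all_field.
From mathcomp Require Import boolp classical_sets functions cardinality.
From mathcomp Require Import ring.

Set Implicit Arguments.
Unset Strict Implicit.
Unset Printing Implicit Defensive.

Import GRing.Theory.
Local Open Scope classical_set_scope.
Local Open Scope ring_scope.

(* Call I and J multiplier-equivalent at p if there are a in (I:J) and b in (J:I)
   with ab in S \ p.  Completion detects exactly this.  If ab = s is outside p,
   multiplication by b is invertible after completion because s is.  Conversely,
   an isomorphism I_p -> J_p induces maps I/p^n I -> J/p^n J; for n large, dividing
   the image of an integer d of I by d produces multipliers congruent to these
   maps modulo p, and the determinant trick turns the product of the two
   multipliers, which is congruent modulo pI to a scalar outside p, into an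
   element outside p.

   With T = R + p^n O one has s T <= R for some s outside p, so the extension
   I |-> IT loses nothing at p.  A maximal ideal of T not containing p is one where
   T agrees with O locally, and there all fractional ideals are equivalent because
   fractional ideals of O are invertible; the same applies to R at the maximal
   ideals not containing (R:O).  Surjectivity is gluing of lattices at finitely
   many maximal ideals. *)

(* Completions are built from sequences of lifts and tensor products from formal sums, so an
   isomorphism of completions is read only at a finite level, where it gives maps that are linear
   modulo p^n J and no better. How large n must be comes from dimension one: for a nonzero integer
   d, the primes of S over d are maximal, so some s outside p and some n satisfy s p^n <= dS. This
   one fact ([order_max_pow]) also gives the levels at which vectors of K are evaluated, the
   elements outside O that make its maximal ideals invertible, and the elements that separate
   maximal ideals in the gluing.

   No localization is formed. A statement at p is a statement in K up to a factor outside p, and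
   finite generation over Z makes one such factor serve a whole lattice. *)
Local Identity Coercion fun_of_set : set >-> Funclass.

(** * Maximal ideals of Noetherian rings *)

Section IdealTheory.
Variable A : comPzRingType.
Implicit Types (I J P : set A) (p : max_ideal A) (x y : A).

Definition noetherian_ring := forall I, is_ideal I -> fg_ideal I.

Lemma max_ideal_ideal p : is_ideal p.
Proof. by case: (max_idealP p). Qed.

Lemma max_ideal0 p : p 0. Proof. by case: (max_ideal_ideal p). Qed.

Lemma max_idealD p x y : p x -> p y -> p (x + y).
Proof. by case: (max_ideal_ideal p) => _ + _; apply. Qed.

Lemma max_idealM p a x : p x -> p (a * x).
Proof. by case: (max_ideal_ideal p) => _ _; apply. Qed.

Lemma max_idealMr p a x : p x -> p (x * a).
Proof. by rewrite mulrC; apply: max_idealM. Qed.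

Lemma max_ideal1 p : ~ p 1. Proof. by case: (max_idealP p). Qed.

Lemma max_ideal_eq (p q : max_ideal A) : p `<=` q -> p = q.
Proof.
move=> pq; have e : p = q :> set A.
  case: (max_idealP p) => _ _ /(_ q (max_ideal_ideal q) pq)[//|qT].
  by case: (@max_ideal1 q); rewrite qT.
by case: p q e {pq} => p pP [q qP] /= e; subst q; congr MaxIdeal; apply: Prop_irrelevance.
Qed.

Definition adjoin I x : set A := [set z | exists a r, I a /\ z = a + r * x].

Lemma adjoin_ideal I x : is_ideal I -> is_ideal (adjoin I x).
Proof.
case=> I0 ID IM; split.
- by exists 0, 0; rewrite mul0r addr0.
- move=> _ _ [a [r [Ia ->]]] [b [s [Ib ->]]]; exists (a + b), (r + s).
  by rewrite mulrDl addrACA; split=> //; apply: ID.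
- move=> c _ [a [r [Ia ->]]]; exists (c * a), (c * r).
  by rewrite mulrDr mulrA; split=> //; apply: IM.
Qed.

Lemma sub_adjoin I x : I `<=` adjoin I x.
Proof. by move=> a Ia; exists a, 0; rewrite mul0r addr0. Qed.

Lemma mem_adjoin I x : is_ideal I -> adjoin I x x.
Proof. by case=> I0 _ _; exists 0, 1; rewrite mul1r add0r. Qed.

Lemma max_ideal_inv p x : ~ p x -> exists r a, p a /\ r * x = 1 - a.
Proof.
move=> px; case: (max_idealP p) => pI _ /(_ _ (adjoin_ideal x pI) (@sub_adjoin p x))[e|e].
  by case: px; rewrite -e; apply: mem_adjoin.
have {e} : adjoin p x 1 by rewrite e.
by case=> a [r [pa e]]; exists r, a; rewrite e [a + _]addrC addrK.
Qed.

Lemma max_ideal_prime p x y : p (x * y) -> p x \/ p y.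
Proof.
move=> pxy; have [px|px] := pselect (p x); [by left | right].
have [r [a [pa e]]] := max_ideal_inv px.
have -> : y = r * (x * y) + a * y by rewrite mulrA e mulrBl mul1r subrK.
by apply: max_idealD; [apply: max_idealM | apply: max_idealMr].
Qed.

Lemma notin_max_idealM p x y : ~ p x -> ~ p y -> ~ p (x * y).
Proof. by move=> px py /max_ideal_prime[]. Qed.

Lemma notin_max_idealX p x n : ~ p x -> ~ p (x ^+ n).
Proof.
move=> px; elim: n => [|n IHn]; first by rewrite expr0; apply: max_ideal1.
by rewrite exprS; apply: notin_max_idealM.
Qed.

Lemma maximal_sub_max_ideal P p : is_maximal_ideal P -> P `<=` p -> P = p.
Proof.
move=> [_ _ /(_ _ (max_ideal_ideal p))] + Pp => /(_ Pp)[//|pT].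
by case: (@max_ideal1 p); rewrite pT.
Qed.

Lemma ideal_pow_mem (I : set A) x n : is_ideal I -> I x -> ideal_pow I n (x ^+ n).
Proof.
by move=> II Ix; elim: n => [//|n IHn]; rewrite exprS; apply: mulsetM.
Qed.

Lemma ideal_powS_sub (I : set A) n : is_ideal I -> ideal_pow I n.+1 `<=` ideal_pow I n.
Proof.
move=> II; have [J0 JD JM] := ideal_pow_ideal n II.
by apply: mulset_ind => // x y _ Jy; apply: JM.
Qed.

Lemma ideal_pow_sub (I : set A) m n : is_ideal I -> (m <= n)%N ->
  ideal_pow I n `<=` ideal_pow I m.
Proof.
move=> II /subnK <-; elim: (n - m)%N => [//|k IHk] x.
by move=> /(ideal_powS_sub II); apply: IHk.
Qed.

Lemma ideal_powD (I : set A) m n : is_ideal I ->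
  ideal_pow I (m + n) `<=` mulset (ideal_pow I m) (ideal_pow I n).
Proof.
move=> II; elim: m => [|m IHm] z; first by move=> Iz; rewrite -[z]mul1r; apply: mulsetM.
move: z; apply: mulset_ind => [|x y|x y Ix /IHm]; [exact: mulset0|exact: mulsetD|].
move: y; apply: mulset_ind => [|y y'|y y' Iy Iy'].
- by rewrite mulr0; apply: mulset0.
- by rewrite mulrDr; apply: mulsetD.
- by rewrite mulrA; apply: mulsetM => //; apply: mulsetM.
Qed.

(** Induction from larger ideals to smaller ones. A failure would give, by choice, a strictly
    increasing chain of counterexamples; its union is finitely generated, hence equal to a member of
    the chain. *)
Lemma noetherian_ind (P : set A -> Prop) : noetherian_ring ->
  (forall I, is_ideal I -> (forall J, is_ideal J -> I `<=` J -> J <> I -> P J) -> P I) ->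
  forall I, is_ideal I -> P I.
Proof.
move=> noeth step I0 II0; apply: contrapT => nP0.
pose bad I := is_ideal I /\ ~ P I.
have /choice[f fP] I : exists J, bad I -> [/\ bad J, I `<=` J & J <> I].
  have [[II nPI]|nb] := pselect (bad I); last by exists I.
  have : ~ (forall J, is_ideal J -> I `<=` J -> J <> I -> P J).
    by move=> h; apply: nPI; apply: step.
  move=> /existsNP[J] /not_implyP[IJ] /not_implyP[sJ] /not_implyP[nJ nPJ].
  by exists J.
pose c n := iter n f I0.
have cbad n : bad (c n) by elim: n => [|n /fP[]].
have cS n : c n `<=` c n.+1 by case: (fP _ (cbad n)).
have cmono m n : (m <= n)%N -> c m `<=` c n.
  move=> /subnK <-; elim: (n - m)%N => [//|k IHk] x /IHk; exact: cS.
pose U := [set x | exists n, c n x].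
have UI : is_ideal U.
  split; first by exists 0%N; case: II0.
  - move=> x y [m xm] [n yn]; exists (maxn m n).
    case: (cbad (maxn m n)) => -[_ cD _] _.
    by apply: cD; [apply: cmono xm; apply: leq_maxl | apply: cmono yn; apply: leq_maxr].
  - by move=> a x [n xn]; exists n; case: (cbad n) => -[_ _ cM] _; apply: cM.
have [s Us] := noeth _ UI.
have sU x : x \in s -> U x.
  move=> xs; rewrite Us; exists (fun i => (i == index x s)%:R).
  have xs' : (index x s < size s)%N by rewrite index_mem.
  rewrite (bigD1 (Ordinal xs')) //= eqxx mul1r nth_index // big1 ?addr0 //.
  by move=> i /negPf ni; rewrite -[_ == _]/(i == Ordinal xs') ni mul0r.
have [N sN] : exists N, forall x, x \in s -> c N x.
  elim: {Us} s sU => [|x s IHs] sU; first by exists 0%N.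
  have [N sN] : exists N, forall y, y \in s -> c N y.
    by apply: IHs => y ys; apply: sU; rewrite inE ys orbT.
  have [m xm] := sU x (mem_head x s).
  exists (maxn m N) => y; rewrite inE => /orP[/eqP->|/sN].
    by apply: cmono xm; apply: leq_maxl.
  by apply: cmono; apply: leq_maxr.
have UN : U `<=` c N.
  rewrite Us => _ [e ->]; case: (cbad N) => -[c0 cD cM] _.
  by elim/big_ind: _ => // i _; apply/cM/sN/mem_nth.
case: (fP _ (cbad N)) => _ _; apply; apply/seteqP; split; last exact: cS.
by move=> x xN; apply: UN; exists N.+1.
Qed.

(** A proper ideal J that is not prime has x, y outside J with xy in J, and then (J + (x))(J + (y))
    <= J with both factors strictly larger than J. This takes the place of primary decomposition. *)
Lemma noetherian_devissage (P : set A -> Prop) I : noetherian_ring -> is_ideal I ->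
  P setT -> (forall J, is_prime_ideal J -> I `<=` J -> P J) ->
  (forall J J1 J2, is_ideal J -> I `<=` J -> P J1 -> P J2 -> J `<=` J1 -> J `<=` J2 ->
     mulset J1 J2 `<=` J -> P J) ->
  P I.
Proof.
move=> noeth II PT Pprime Pmul.
suff: forall J, is_ideal J -> I `<=` J -> P J by apply.
apply: (noetherian_ind noeth) => J IJ IHJ sIJ.
have [J1|J1] := pselect (J 1).
  suff -> : J = setT by [].
  by apply/seteqP; split=> // x _; rewrite -[x]mulr1; case: IJ => _ _; apply.
have [Jp|/existsNP[x /existsNP[y /not_implyP[Jxy /not_orP[Jx Jy]]]]] :=
    pselect (forall x y, J (x * y) -> J x \/ J y).
  by apply: Pprime.
have Padj z : ~ J z -> P (adjoin J z).
  move=> Jz; apply: IHJ; [exact: adjoin_ideal | exact: sub_adjoin | |].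
    by move=> e; apply: Jz; rewrite -e; apply: mem_adjoin.
  by apply: subset_trans sIJ _; apply: sub_adjoin.
apply: (Pmul J _ _ IJ sIJ (Padj x Jx) (Padj y Jy)); [exact: sub_adjoin | exact: sub_adjoin |].
have [J0 JD JM] := IJ.
apply: mulset_ind => // _ _ [a [r [Ja ->]]] [b [s [Jb ->]]].
rewrite mulrDl; apply: (JD); first by rewrite mulrC; apply: JM.
rewrite mulrDr; apply: (JD); first exact: JM.
by rewrite mulrACA; apply: JM.
Qed.

Lemma noetherian_max_ideal I : noetherian_ring -> is_ideal I -> ~ I 1 ->
  exists p : max_ideal A, I `<=` p.
Proof.
move=> noeth; move: I; apply: (noetherian_ind noeth) => I II IHI I1.
have [Imax|Imax] := pselect (is_maximal_ideal I); first by exists (MaxIdeal Imax).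
have /existsNP[J /not_implyP[IJ /not_implyP[sIJ /not_orP[nJ JT]]]] :
    ~ forall J, is_ideal J -> I `<=` J -> J = I \/ J = setT.
  by move=> h; apply: Imax.
have [J1|p Jp] := IHI J IJ sIJ nJ; last by exists p; apply: subset_trans Jp.
apply: JT; apply/seteqP; split=> // x _.
by rewrite -[x]mulr1; case: IJ => _ _; apply.
Qed.

(** A maximal ideal containing J1 J2 contains J1 or J2, so the sets add up along the devissage; a
    prime over I is maximal, hence the only maximal ideal over itself. *)
Lemma finite_max_ideals I : noetherian_ring -> is_ideal I ->
  (forall P, is_prime_ideal P -> I `<=` P -> is_maximal_ideal P) ->
  finite_set [set p : max_ideal A | I `<=` p].
Proof.
move=> noeth II maxI.
apply: (noetherian_devissage (P := fun J => finite_set [set p : max_ideal A | J `<=` p])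
  noeth II) => [|P Pprime IP|J J1 J2 IJ _ fin1 fin2 _ _ J12].
- apply: (@sub_finite_set _ _ set0); last exact: finite_set0.
  by move=> p /(_ 1 Logic.I) /max_ideal1.
- have Pmax := maxI _ Pprime IP.
  apply: (@sub_finite_set _ _ [set MaxIdeal Pmax]); last exact: finite_set1.
  by move=> p /= Pp; apply/esym; apply: max_ideal_eq.
- apply: (@sub_finite_set _ _ ([set p : max_ideal A | J1 `<=` p] `|`
     [set p : max_ideal A | J2 `<=` p])); last by rewrite finite_setU.
  move=> p Jp; have [J1p|/existsNP[x /not_implyP[J1x px]]] := pselect (J1 `<=` p).
    by left.
  right=> y J2y; have : p (x * y) by apply/Jp/J12/mulsetM.
  by case/max_ideal_prime.
Qed.

(** Locally at p, the ideal I contains a power of p. For a prime P other than p, an element of P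
    outside p serves as s with n = 0; for P = p take s = 1 and n = 1; along products the s multiply
    and the n add. *)
Lemma max_ideal_pow_sub p I : noetherian_ring -> is_ideal I ->
  (forall P, is_prime_ideal P -> I `<=` P -> is_maximal_ideal P) ->
  exists s n, ~ p s /\ forall y, ideal_pow p n y -> I (s * y).
Proof.
move=> noeth II maxI; have pI := max_ideal_ideal p.
apply: (noetherian_devissage (P := fun J => exists s n, ~ p s /\
   forall y, ideal_pow p n y -> J (s * y)) noeth II) => [|P Pprime IP|J J1 J2 IJ _].
- by exists 1, 0%N; split=> //; apply: max_ideal1.
- have [PI _ _] := Pprime; have [P0 PD PM] := PI.
  have [Pp|/existsNP[x /not_implyP[Px px]]] := pselect (P `<=` p); last first.
    by exists x, 0%N; split=> // y _; rewrite mulrC; apply: PM.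
  exists 1, 1%N; split=> [|y]; first exact: max_ideal1.
  rewrite (maximal_sub_max_ideal (maxI _ Pprime IP) Pp) mul1r.
  move: y; apply: mulset_ind; first exact: max_ideal0.
    exact: max_idealD.
  by move=> x y px _; apply: max_idealMr.
move=> [s1 [n1 [ps1 sJ1]]] [s2 [n2 [ps2 sJ2]]] _ _ J12.
exists (s1 * s2), (n1 + n2)%N; split; first exact: notin_max_idealM.
have [J0 JD JM] := IJ.
move=> y /(ideal_powD pI); move: y; apply: mulset_ind => [|x y|x y px py].
- by rewrite mulr0.
- by rewrite mulrDr; apply: JD.
- by rewrite mulrACA; apply/J12/mulsetM; [apply: sJ1 | apply: sJ2].
Qed.

End IdealTheory.

(** * Completion and base change *)

Section CompletionTheory.
Variables (A : comPzRingType) (p : max_ideal A).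
Implicit Types (a : A) (c d : completion p) (m n : nat).

Let pX n : is_ideal (ideal_pow p n).
Proof. exact/ideal_pow_ideal/max_ideal_ideal. Qed.
Let pXD n x y : ideal_pow p n x -> ideal_pow p n y -> ideal_pow p n (x + y).
Proof. by case: (pX n) => _ + _; apply. Qed.

(** If ra = 1 - b with b in p, the inverse is r times the geometric series in b, whose n-th partial
    sum is the lift modulo p^n. *)
Lemma to_completion_unit a : ~ p a -> exists c, to_completion p a * c = 1.
Proof.
move=> pa; have [r [b [pb e]]] := max_ideal_inv pa.
have coh : coherent p (fun n => r * \sum_(i < n) b ^+ i).
  move=> n; rewrite big_ord_recr mulrDr /= addrC addKr.
  by case: (pX n) => _ _; apply; exact: ideal_pow_mem (max_ideal_ideal p) pb.
exists (compl_class (mk_cohseq coh)).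
rewrite -[LHS]/(compl_mul (compl_class _) (compl_class _)) compl_mulE.
apply/compl_eqP => n /=; rewrite mulrA [a * r]mulrC e.
rewrite -[1 - b]opprB mulNr -subrX1 opprB addrC addKr.
apply: (ideal_oppr (pX n)); exact: ideal_pow_mem (max_ideal_ideal p) pb.
Qed.

Lemma repr_to_completion a n : ideal_pow p n (repr (to_completion p a) n - a).
Proof. exact: compl_reprP. Qed.

Lemma repr_complD c d n : ideal_pow p n (repr (c + d) n - (repr c n + repr d n)).
Proof. exact: compl_reprP. Qed.

Lemma repr_complM c d n : ideal_pow p n (repr (c * d) n - repr c n * repr d n).
Proof. exact: compl_reprP. Qed.

Lemma repr_compl_sub c m n : (m <= n)%N -> ideal_pow p m (repr c n - repr c m).
Proof.
move=> /subnK <-; elim: (n - m)%N => [|k IHk].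
  by rewrite subrr; case: (pX m).
rewrite -(subrKA (repr c (k + m)%N)); apply: pXD => //.
by apply: (@ideal_pow_sub _ _ _ (k + m)); [exact: max_ideal_ideal | exact: leq_addl | exact: cohseqP].
Qed.

End CompletionTheory.

(* A vector x is only evaluated at level nu x, at which V absorbs the
   ambiguity of the lifts to A of elements of the completion. *)
Section Evaluation.
Variables (A : comPzRingType) (p : max_ideal A) (M : lmodType A).
Variables (V : set M) (nu : M -> nat).
Hypotheses (V0 : V 0) (VD : forall x y, V x -> V y -> V (x + y)).
Hypotheses (VN : forall x, V x -> V (- x)).
Hypothesis Vnu : forall x n a, (nu x <= n)%N -> ideal_pow p n a -> V (a *: x).
Implicit Types (s t : seq (M * completion p)) (z w : base_change (to_completion p) M).

Definition lift_eval s : M := \sum_(u <- s) repr u.2 (nu u.1) *: u.1.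

Let Vsym x y : V (x - y) -> V (y - x).
Proof. by move=> /VN; rewrite opprB. Qed.
Let Vtrans y x x' : V (x - y) -> V (y - x') -> V (x - x').
Proof. by move=> xy yz; rewrite -(subrKA y); apply: VD. Qed.

Let lift_eval_level x (c : completion p) n : (nu x <= n)%N ->
  V (repr c n *: x - repr c (nu x) *: x).
Proof. by move=> xn; rewrite -scalerBl; apply: (Vnu (leqnn _)); apply: repr_compl_sub. Qed.

Lemma lift_eval_cat s t : lift_eval (s ++ t) = lift_eval s + lift_eval t.
Proof. exact: big_cat. Qed.

Lemma lift_eval1 x (c : completion p) n : (nu x <= n)%N ->
  V (repr c n *: x - lift_eval [:: (x, c)]).
Proof. by rewrite /lift_eval big_seq1; apply: lift_eval_level. Qed.

Lemma lift_eval_rel s t : tensor_rel (to_completion p) s t ->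
  V (lift_eval s - lift_eval t).
Proof.
elim=> {s t} [s|s t _|s t u _ ih1 _ ih2|s s' t t' _ ih1 _ ih2|s t|x y b|x b c|a x b|b].
- by rewrite subrr.
- exact: Vsym.
- exact: Vtrans ih1 ih2.
- by rewrite !lift_eval_cat opprD addrACA; apply: VD.
- by rewrite !lift_eval_cat [lift_eval t + _]addrC subrr.
(* The three vectors are evaluated at different levels; all are compared with level n, which is
   above each of them. *)
- pose n := maxn (nu (x + y)) (maxn (nu x) (nu y)).
  rewrite -[X in lift_eval X - _]/([:: (x + y, b)]) -[[:: _; _]]/([:: _] ++ [:: _]).
  rewrite lift_eval_cat.
  apply: (Vtrans (y := repr b n *: (x + y))).
    by apply/Vsym/lift_eval1; rewrite leq_maxl.
  rewrite scalerDr opprD addrACA; apply: VD; apply: lift_eval1.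
    by rewrite /n leq_max leq_maxl orbT.
  by rewrite /n leq_max leq_maxr orbT.
- rewrite -[[:: _; _]]/([:: _] ++ [:: _]) lift_eval_cat /lift_eval !big_seq1 /=.
  by rewrite -scalerDl -scalerBl; apply: (Vnu (leqnn _)); apply: repr_complD.
- pose n := maxn (nu (a *: x)) (nu x).
  apply: (Vtrans (y := repr b n *: (a *: x))).
    by apply/Vsym/lift_eval1; rewrite leq_maxl.
  apply: (Vtrans (y := repr (to_completion p a * b) n *: x)); last first.
    by apply: lift_eval1; rewrite leq_maxr.
  rewrite scalerA -scalerBl; apply: (Vnu (leq_maxr _ _ : (_ <= n)%N)).
  rewrite -opprB; apply: (ideal_oppr (ideal_pow_ideal _ (max_ideal_ideal p))).
  rewrite -(subrKA (repr (to_completion p a) n * repr b n)) [repr b n * a]mulrC -mulrBl.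
  have [_ pD pM] := ideal_pow_ideal n (max_ideal_ideal p).
  apply: (pD); first exact: repr_complM.
  by rewrite mulrC; apply: pM; apply: repr_to_completion.
- by rewrite /lift_eval big_seq1 big_nil scaler0 subrr.
Qed.

Definition bc_eval z : M := lift_eval (repr z).

Lemma bc_evalE s : V (bc_eval (bc_class (to_completion p) s) - lift_eval s).
Proof. exact/lift_eval_rel/bc_reprP. Qed.

Lemma bc_evalD z w : V (bc_eval (z + w) - (bc_eval z + bc_eval w)).
Proof. by rewrite -lift_eval_cat; apply: bc_evalE. Qed.

Lemma bc_eval1 x : V (bc_eval (bc_class (to_completion p) [:: (x, 1)]) - x).
Proof.
apply: (Vtrans (bc_evalE _)); rewrite /lift_eval big_seq1 /=.
rewrite -{3}[x]scale1r -scalerBl; apply: (Vnu (leqnn _)).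
exact: (repr_to_completion p 1).
Qed.

End Evaluation.

Section ConstantLevel.
Variables (A : comPzRingType) (p : max_ideal A) (M : lmodType A) (n : nat).
Variable V : set M.
Hypotheses (V0 : V 0) (VD : forall x y, V x -> V y -> V (x + y)).
Hypotheses (VZ : forall a x, V x -> V (a *: x)).
Hypothesis Vn : forall x a, ideal_pow p n a -> V (a *: x).

Let VN x : V x -> V (- x). Proof. by rewrite -scaleN1r; apply: VZ. Qed.
Let Vnu x m a : (n <= m)%N -> ideal_pow p m a -> V (a *: x).
Proof. by move=> nm /(ideal_pow_sub (max_ideal_ideal p) nm); apply: Vn. Qed.

(** With a constant level, the single lift [repr c n] serves all the terms of z. *)
Lemma bc_evalZ (c : completion p) (z : base_change (to_completion p) M) :
  V (bc_eval (fun=> n) (c *: z) - repr c n *: bc_eval (fun=> n) z).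
Proof.
rewrite -(subrKA (lift_eval (fun=> n) (bc_scale_seq c (repr z)))); apply: VD.
  exact: (bc_evalE V0 VD VN Vnu).
rewrite /bc_eval /lift_eval; elim: (repr z) => [|[x d] s IHs].
  by rewrite !big_nil scaler0 subrr.
rewrite !big_cons scalerDr opprD addrACA; apply: VD => //=.
by rewrite scalerA -scalerBl; apply/Vn/repr_complM.
Qed.

End ConstantLevel.

Lemma bc_class_repr (A B : comPzRingType) (f : {rmorphism A -> B}) (M : lmodType A)
    (z : base_change f M) : bc_class f (repr z) = z.
Proof. exact: reprK. Qed.

Section BaseChangeMap.
Variables (A B : comPzRingType) (f : {rmorphism A -> B}) (M N : lmodType A).
Variable g : {linear M -> N}.

Definition bc_map_seq (s : seq (M * B)) : seq (N * B) := [seq (g u.1, u.2) | u <- s].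
Definition bc_map (z : base_change f M) : base_change f N :=
  bc_class f (bc_map_seq (repr z)).

Lemma bc_map_rel s t : tensor_rel f s t -> tensor_rel f (bc_map_seq s) (bc_map_seq t).
Proof.
elim=> {s t} [s|s t _|s t u _ ih1 _ ih2|s s' t t' _ ih1 _ ih2|s t|x y b|x b c|a x b|b].
- exact: Tensor_refl.
- exact: Tensor_sym.
- exact: Tensor_trans ih1 ih2.
- by rewrite /bc_map_seq !map_cat; apply: Tensor_cat.
- by rewrite /bc_map_seq !map_cat; apply: Tensor_catC.
- by rewrite /= linearD; apply: Tensor_addl.
- exact: Tensor_addr.
- by rewrite /= linearZ; apply: Tensor_scale.
- by rewrite /= linear0; apply: Tensor_zero.
Qed.

Lemma bc_mapE s : bc_map (bc_class f s) = bc_class f (bc_map_seq s).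
Proof. exact/bc_classP/bc_map_rel/bc_reprP. Qed.

Lemma bc_map_linear : linear bc_map.
Proof.
move=> c z w; rewrite -(bc_class_repr z) -(bc_class_repr w).
move: (repr z) (repr w) => s t.
rewrite -[c *: _]/(bc_scale c _) -[_ + bc_class f t]/(bc_add _ _).
rewrite bc_scaleE bc_addE !bc_mapE.
rewrite -[c *: _]/(bc_scale c _) -[_ + bc_class f _]/(bc_add _ _).
rewrite bc_scaleE bc_addE /bc_map_seq map_cat /bc_scale_seq.
by congr bc_class; congr cat; rewrite -!map_comp.
Qed.
HB.instance Definition _ := GRing.isLinear.Build _ _ _ _ bc_map bc_map_linear.

End BaseChangeMap.

(** For f the map to the completion at p and a outside p, the scalar f a is a unit, so the two
    base-changed maps are inverse up to a unit. *)
Lemma bc_map_scale (A B : comPzRingType) (f : {rmorphism A -> B}) (M N : lmodType A)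
    (g : {linear M -> N}) (h : {linear N -> M}) a :
  (forall x, h (g x) = a *: x) ->
  forall z : base_change f M, bc_map h (bc_map g z) = f a *: z.
Proof.
move=> hg z; rewrite -(bc_class_repr z); move: (repr z) => s; rewrite !bc_mapE.
rewrite -[RHS]/(bc_scale _ _) bc_scaleE; elim: s => [//|[x b] s IHs].
rewrite /= -cat1s -[in RHS]cat1s -!bc_addE; congr bc_add => //.
by rewrite /= hg; apply/bc_classP/Tensor_scale.
Qed.

(** * Orders *)

(** The matrix u - C kills the vector x; multiplying by its adjugate shows that its determinant, the
    characteristic polynomial of C at u, kills each coordinate. The map f lets C have its entries in
    Z or in an order while u lives in a larger ring. *)
Lemma det_trick (B E : comNzRingType) (f : {rmorphism B -> E}) k (x : 'I_k -> E)
    (C : 'M[B]_k) (u : E) :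
  (forall i, u * x i = \sum_j f (C i j) * x j) ->
  forall j, (map_poly f (char_poly C)).[u] * x j = 0.
Proof.
move=> ux; pose D : 'M[E]_k := u%:M - map_mx f C.
have detD : (map_poly f (char_poly C)).[u] = \det D.
  rewrite map_char_poly /char_poly -/(horner_eval u _) -det_map_mx; congr (\det _).
  by apply/matrixP => i j; rewrite !mxE /= /horner_eval hornerD hornerN hornerMn hornerX hornerC.
have Dx : D *m \col_i x i = 0.
  apply/matrixP => i j; rewrite !mxE.
  under eq_bigr do rewrite !mxE mulrBl.
  rewrite big_split /= sumrN -ux (bigD1 i) //= eqxx mulr1n big1 ?addr0 ?subrr //.
  by move=> l /negPf li; rewrite eq_sym li mulr0n mul0r.
move=> j; have := congr1 (mulmx (\adj D)) Dx; rewrite mulmxA mul_adj_mx mulmx0.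
by move=> /matrixP/(_ j 0); rewrite mul_scalar_mx !mxE detD.
Qed.

Section IntegerScalars.
Variables (Z : idomainType) (K : comAlgType {fraction Z}).
Implicit Types (a d : Z) (x y : K) (X : set K).

Definition Zemb a : K := Zscale a 1.

Lemma ZscaleE a x : Zscale a x = Zemb a * x.
Proof. by rewrite /Zemb /Zscale -scalerAl mul1r. Qed.

Lemma ZembM a d : Zemb (a * d) = Zemb a * Zemb d.
Proof. by rewrite -ZscaleE /Zemb ZscaleA. Qed.

Lemma Zemb_inj d x y : d != 0 -> Zemb d * x = Zemb d * y -> x = y.
Proof.
move=> d0; rewrite -!ZscaleE /Zscale => /(congr1 ( *:%R (tofrac d)^-1)).
by rewrite !scalerA mulVf ?tofrac_eq0 // !scale1r.
Qed.

Lemma Zemb_divr d x : d != 0 -> exists y, x = Zemb d * y.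
Proof.
move=> d0; exists ((tofrac d)^-1 *: x).
by rewrite -ZscaleE /Zscale scalerA divff ?tofrac_eq0 // scale1r.
Qed.

Lemma is_latticeD X x y : is_lattice X -> X x -> X y -> X (x + y).
Proof. by move=> /is_lattice_submodule[_ + _]; apply. Qed.

Lemma is_lattice0 X : is_lattice X -> X 0.
Proof. by move=> /is_lattice_submodule[]. Qed.

Lemma is_latticeN X x : is_lattice X -> X x -> X (- x).
Proof. by move=> /is_lattice_submodule; apply: Zsubmodule_opp. Qed.

Lemma is_lattice_Zemb X : is_lattice X -> exists d, d != 0 /\ X (Zemb d).
Proof. exact: is_lattice1. Qed.

Lemma is_latticeZ X a x : is_lattice X -> X x -> X (Zemb a * x).
Proof. by rewrite -ZscaleE => /is_lattice_submodule[_ _ +]; apply. Qed.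

(** A lattice contains a Q-basis, so a common denominator of the coordinates settles one vector, and
    a product of denominators a finite list. *)
Lemma Zspan_denom X (s : seq K) : is_lattice X ->
  exists d, d != 0 /\ forall x, Zspan s x -> X (Zemb d * x).
Proof.
move=> latX; have Xmod := is_lattice_submodule latX.
have one x : exists d, d != 0 /\ X (Zemb d * x).
  case: (latX) => _ [k [b [bbasis bX]]]; have [c [-> _]] := bbasis x.
  have [d [n [d0 dn]]] := frac_common_denom c; exists d; split=> //.
  rewrite -ZscaleE /Zscale scaler_sumr; apply: (Zsubmodule_sum Xmod) => i.
  by rewrite scalerA dn; case: Xmod => _ _; apply.
elim: s => [|x s [d [d0 IHs]]].
  exists 1; split; first exact: oner_neq0.
  by move=> x; rewrite Zspan_nil => ->; rewrite mulr0; apply: is_lattice0.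
have [e [e0 ex]] := one x; exists (d * e); split; first exact: mulf_neq0.
move=> _ /Zspan_consP[a [z [/IHs zX ->]]]; rewrite mulrDr; apply: is_latticeD => //.
  rewrite ZscaleE mulrCA; apply: is_latticeZ => //.
  by rewrite ZembM -mulrA; apply: is_latticeZ.
by rewrite ZembM [Zemb d * _]mulrC -mulrA; apply: is_latticeZ.
Qed.

Lemma lattice_denom X Y : is_lattice X -> is_lattice Y ->
  exists d, d != 0 /\ forall x, Y x -> X (Zemb d * x).
Proof. by move=> latX [[s ->] _]; apply: Zspan_denom. Qed.

(** Finite generation comes from Z being Noetherian, and the basis is that of Y scaled by d. *)
Lemma sub_is_lattice X Y d : dedekind_domain Z -> is_Zsubmodule X -> d != 0 ->
  (forall y, Y y -> X (Zemb d * y)) -> X `<=` Y -> is_lattice Y -> is_lattice X.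
Proof.
move=> dedZ Xmod d0 dYX XY [[s Ys] [k [b [bbasis bY]]]]; split.
  by apply: (Zspan_noetherian dedZ Xmod (s := s)); rewrite -Ys.
have fd0 : tofrac d != 0 by rewrite tofrac_eq0.
exists k, (fun i => Zemb d * b i); split=> [x|i]; last exact/dYX.
have [c [cx cU]] := bbasis x; exists [ffun i => c i / tofrac d]; split=> [|c' c'x].
  rewrite cx; apply: eq_bigr => i _.
  by rewrite ffunE -ZscaleE /Zscale scalerA mulfVK.
have cE : c = [ffun i => c' i * tofrac d].
  by apply: cU; rewrite c'x; apply: eq_bigr => i _; rewrite ffunE -ZscaleE /Zscale scalerA.
by apply/ffunP => i; rewrite cE !ffunE mulfK.
Qed.

End IntegerScalars.

Section OrderTheory.
Variables (Z : idomainType) (dedZ : dedekind_domain Z) (K : comAlgType {fraction Z}).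
Variable S : Zorder K.
Implicit Types (a d : Z) (x y : K) (r : order_ring S).

Lemma order1 : Zorder_set S 1. Proof. by case: (Zorder_subring S). Qed.
Lemma orderM x y : Zorder_set S x -> Zorder_set S y -> Zorder_set S (x * y).
Proof. by case: (Zorder_subring S) => _ _; apply. Qed.
Lemma orderD x y : Zorder_set S x -> Zorder_set S y -> Zorder_set S (x + y).
Proof. exact: (is_latticeD (Zorder_lattice S)). Qed.
Lemma order_Zemb a : Zorder_set S (Zemb K a).
Proof.
rewrite /Zemb ZscaleE; apply: is_latticeZ (Zorder_lattice S) _.
exact: order1.
Qed.
Lemma order_val0 : val (0 : order_ring S) = 0. Proof. exact: rmorph0. Qed.
Lemma order_val1 : val (1 : order_ring S) = 1. Proof. exact: rmorph1. Qed.
Lemma order_valD r r' : val (r + r') = val r + val r'. Proof. exact: rmorphD. Qed.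
Lemma order_valB r r' : val (r - r') = val r - val r'. Proof. exact: rmorphB. Qed.
Lemma order_valM r r' : val (r * r') = val r * val r'. Proof. exact: rmorphM. Qed.
Lemma order_valX r n : val (r ^+ n) = val r ^+ n. Proof. exact: rmorphXn. Qed.

Definition to_order x (Sx : Zorder_set S x) : order_ring S :=
  OrderRing (mem_set Sx : x \in Zorder_pred S).

Definition Zorder_emb a : order_ring S := to_order (order_Zemb a).

Lemma Zorder_emb_additive : zmod_morphism Zorder_emb.
Proof.
move=> a b; apply: val_inj; rewrite rmorphB /= /Zemb.
by rewrite ZscaleDl -[in Zscale (- b)]mulN1r -ZscaleA ZscaleN1.
Qed.
Lemma Zorder_emb_multiplicative : monoid_morphism Zorder_emb.
Proof.
split; first by apply: val_inj; rewrite rmorph1; apply: Zscale1.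
by move=> a b; apply: val_inj; rewrite rmorphM /=; apply: ZembM.
Qed.
HB.instance Definition _ :=
  GRing.isZmodMorphism.Build Z (order_ring S) Zorder_emb Zorder_emb_additive.
HB.instance Definition _ :=
  GRing.isMonoidMorphism.Build Z (order_ring S) Zorder_emb Zorder_emb_multiplicative.

Lemma order_span (s : seq K) : S = Zspan s :> set K ->
  exists t : seq (order_ring S), map val t = s.
Proof.
move=> Ss; have : forall x, x \in s -> Zorder_set S x.
  by move=> x xs; rewrite Ss; apply: Zspan_mem.
elim: {Ss} s => [|x s IHs] sS; first by exists [::].
have [|t ts] := IHs; first by move=> y ys; apply: sS; rewrite inE ys orbT.
by exists (to_order (sS x (mem_head x s)) :: t); rewrite /= ts.
Qed.

(** The polynomial is the characteristic polynomial of a matrix of multiplication by r on generators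
    of S over Z. Its value at r kills the generators, hence kills 1. *)
Lemma order_integral r :
  exists f : {poly Z}, f \is monic /\ (map_poly Zorder_emb f).[r] = 0.
Proof.
have [[s Ss] _] := Zorder_lattice S; have [t ts] := order_span Ss.
have comb r' : exists c : nat -> Z, r' = \sum_(j < size t) Zorder_emb (c j) * t`_j.
  have : Zspan s (val r') by rewrite -Ss; apply: order_valP.
  move=> [c rc]; exists c; apply: val_inj; rewrite rc rmorph_sum -ts size_map.
  by apply: eq_bigr => j _; rewrite rmorphM /= (nth_map 0) // ZscaleE.
have /choice[C CP] (i : 'I_(size t)) := comb (r * t`_i).
exists (char_poly (\matrix_(i, j) C i j)); split; first exact: char_poly_monic.
have zero : forall j : 'I_(size t),
    (map_poly Zorder_emb (char_poly (\matrix_(i, j < size t) C i j))).[r] * t`_j = 0.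
  apply: det_trick => i; rewrite CP; apply: eq_bigr => j _; by rewrite mxE.
have [c c1] := comb 1.
rewrite -[LHS]mulr1 c1 mulr_sumr big1 // => j _.
by rewrite mulrCA zero mulr0.
Qed.

(** The contraction q of P to Z is a nonzero prime, hence maximal, and S/P is a domain integral over
    the field Z/q, hence a field. *)
Lemma order_prime_max (P : set (order_ring S)) d : is_prime_ideal P -> d != 0 ->
  P (Zorder_emb d) -> is_maximal_ideal P.
Proof.
move=> Pprime d0 Pd; have [PI P1 Pmul] := Pprime; have [P0 PD PM] := PI.
pose q : set Z := [set a | P (Zorder_emb a)].
have qprime : is_prime_ideal q.
  split; first split.
  - by rewrite /q /= rmorph0.
  - by move=> a b qa qb; rewrite /q /= rmorphD; apply: PD.
  - by move=> a b qb; rewrite /q /= rmorphM; apply: PM.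
  - by rewrite /q /= rmorph1.
  - by move=> a b; rewrite /q /= rmorphM; apply: Pmul.
have qmax : is_maximal_ideal q.
  apply: (dedekind_dim1 dedZ qprime) => q0; move/eqP: d0; apply.
  by have : q d := Pd; rewrite q0.
have inv (x : order_ring S) : ~ P x -> exists y : order_ring S, P (x * y - 1).
  move=> Px; have [f [fmon f0]] := order_integral x.
  have : P (map_poly Zorder_emb f).[x] by rewrite f0.
  (* Write the monic equation of x as f X + c. If c lies in q, then P, being prime, contains f(x)
     and the degree drops; otherwise c is invertible modulo q, and f(x) times minus that inverse is
     an inverse of x. *)
  elim/poly_ind: f fmon {f0} => [|f c IHf]; first by rewrite monicE lead_coef0 eq_sym oner_eq0.
  have [->|f0] := eqVneq f 0.
    rewrite mul0r add0r monicE lead_coefC => /eqP->.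
    by rewrite map_polyC hornerC /= rmorph1.
  move=> fmon; have {}fmon : f \is monic.
    move: fmon; rewrite !monicE lead_coefDl ?lead_coefMX //.
    rewrite size_polyC size_mulX //; case: (c != 0) => //=.
    by rewrite ltnS size_poly_gt0.
  rewrite rmorphD rmorphM /= map_polyX map_polyC !hornerE /=.
  have [qc|qc] := pselect (q c).
    move=> Pf; apply: (IHf fmon).
    have /Pmul[//|] : P ((map_poly Zorder_emb f).[x] * x); last by [].
    rewrite -[_ * x](addrK (Zorder_emb c)); apply: (PD) => //.
    exact: (ideal_oppr PI).
  have [r [b [qb rb]]] := @max_ideal_inv _ (MaxIdeal qmax) c qc.
  move=> /(PM (Zorder_emb (- r))) Pf; exists (Zorder_emb (- r) * (map_poly Zorder_emb f).[x]).
  rewrite mulrCA [x * _]mulrC.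
  have -> : Zorder_emb (- r) * ((map_poly Zorder_emb f).[x] * x) - 1 =
     Zorder_emb (- r) * ((map_poly Zorder_emb f).[x] * x + Zorder_emb c) - Zorder_emb b.
    have -> : b = 1 - r * c by rewrite rb opprB addrC subrK.
    rewrite rmorphB rmorph1 rmorphM rmorphN !mulNr mulrDr opprD opprB.
    by rewrite addrA subrK.
  by apply: (PD) => //; apply: (ideal_oppr PI).
split=> // J JI PJ; have [JP|/existsNP[x /not_implyP[Jx Px]]] := pselect (J `<=` P).
  by left; apply/seteqP.
right; have [y Pxy] := inv x Px; apply/seteqP; split=> // z _.
have [_ JD JM] := JI.
have J1 : J 1.
  rewrite -[1](subrK (x * y)) -opprB; apply: (JD); last by rewrite mulrC; apply: JM.
  exact/(ideal_oppr JI)/PJ.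
by rewrite -[z]mulr1; apply: JM.
Qed.

Lemma order_noetherian : noetherian_ring (order_ring S).
Proof.
move=> I II; have [I0 ID IM] := II; have [[s Ss] _] := Zorder_lattice S.
have Imod : is_Zsubmodule (val @` I).
  split; first by exists 0 => //; rewrite rmorph0.
  - by move=> _ _ [x Ix <-] [y Iy <-]; exists (x + y); [apply: ID | rewrite rmorphD].
  - move=> a _ [x Ix <-]; exists (Zorder_emb a * x); first exact: IM.
    by rewrite rmorphM /= ZscaleE.
have [|t It] := Zspan_noetherian (s := s) dedZ Imod.
  by rewrite -Ss => _ [x _ <-]; apply: order_valP.
have [t' [t't t'I]] : exists t' : seq (order_ring S),
    map val t' = t /\ forall r, r \in t' -> I r.
  have : forall x, x \in t -> (val @` I) x by move=> x xt; rewrite It; apply: Zspan_mem.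
  elim: {It} t => [|x t IHt] tI; first by exists [::].
  have [|t' [t't t'I]] := IHt; first by move=> y yt; apply: tI; rewrite inE yt orbT.
  have [r Ir rx] := tI x (mem_head x t); exists (r :: t').
  by split=> [|y]; [rewrite /= t't -rx | rewrite inE => /orP[/eqP->|/t'I]].
exists t'; apply/seteqP; split=> [x Ix|x [c ->]]; last first.
  by elim/big_ind: _ => // i _; apply/IM/t'I/mem_nth.
have : (val @` I) (val x) by exists x.
rewrite It -t't => -[c xc]; exists (Zorder_emb \o c); apply: val_inj.
rewrite xc rmorph_sum size_map; apply: eq_bigr => i _.
by rewrite rmorphM /= (nth_map 0) // ZscaleE.
Qed.

Lemma order_max_pow (p : max_ideal (order_ring S)) d : d != 0 ->
  exists s n, ~ p s /\ forall r, ideal_pow p n r -> exists z, s * r = Zorder_emb d * z.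
Proof.
move=> d0; pose I := [set x | exists z, x = Zorder_emb d * z].
have II : is_ideal I.
  split; first by exists 0; rewrite mulr0.
  - by move=> _ _ [x ->] [y ->]; exists (x + y); rewrite mulrDr.
  - by move=> a _ [x ->]; exists (a * x); rewrite mulrCA.
apply: (max_ideal_pow_sub p order_noetherian II) => P Pprime IP.
by apply: (order_prime_max Pprime d0); apply: IP; exists 1; rewrite mulr1.
Qed.

Lemma finite_max_ideals_over d : d != 0 ->
  finite_set [set p : max_ideal (order_ring S) | p (Zorder_emb d)].
Proof.
move=> d0; pose I := [set x | exists z, x = Zorder_emb d * z].
have II : is_ideal I.
  split; first by exists 0; rewrite mulr0.
  - by move=> _ _ [x ->] [y ->]; exists (x + y); rewrite mulrDr.
  - by move=> a _ [x ->]; exists (a * x); rewrite mulrCA.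
have Id : I (Zorder_emb d) by exists 1; rewrite mulr1.
apply: (@sub_finite_set _ _ [set p : max_ideal (order_ring S) | I `<=` p]).
  by move=> p pd _ [z ->]; apply: max_idealMr.
apply: (finite_max_ideals order_noetherian II) => P Pprime IP.
by apply: (order_prime_max Pprime d0); apply: IP.
Qed.

End OrderTheory.

(** * Local equivalence of fractional ideals *)

Section CompletionMaps.
Variables (A : comPzRingType) (p : max_ideal A) (n : nat).

(** The model is V = p^n M: the quotient M/V is a module killed by p^n, so elements of the
    completion act on it through their lifts at level n. *)
Definition absorbing (M : lmodType A) (V : set M) :=
  [/\ V 0, forall x y, V x -> V y -> V (x + y), forall a x, V x -> V (a *: x)
    & forall x a, ideal_pow p n a -> V (a *: x)].

Variables (M N : lmodType A) (V : set M) (W : set N).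
Hypotheses (absV : absorbing V) (absW : absorbing W).
Variable g : {linear base_change (to_completion p) M -> base_change (to_completion p) N}.

Local Notation unit_tensor x := (bc_class (to_completion p) [:: (x, 1)]).
Local Notation ev := (bc_eval (fun=> n)).

(** A lift of the map that g induces from M to N/W. It is linear only modulo W. *)
Definition level_map (x : M) : N := ev (g (unit_tensor x)).

Let W0 : W 0. Proof. by case: absW. Qed.
Let WD x y : W x -> W y -> W (x + y). Proof. by case: absW => _ + _ _; apply. Qed.
Let WZ a x : W x -> W (a *: x). Proof. by case: absW => _ _ + _; apply. Qed.
Let Wn x a : ideal_pow p n a -> W (a *: x). Proof. by case: absW => _ _ _; apply. Qed.
Let WN x : W x -> W (- x). Proof. by rewrite -scaleN1r; apply: WZ. Qed.
Let Wnu (x : N) m a : (n <= m)%N -> ideal_pow p m a -> W (a *: x).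
Proof. by move=> nm /(ideal_pow_sub (max_ideal_ideal p) nm); apply: Wn. Qed.
Let Wtrans y x x' : W (x - y) -> W (y - x') -> W (x - x').
Proof. by move=> xy yx'; rewrite -(subrKA y); apply: WD. Qed.
Let Wsym x y : W (x - y) -> W (y - x).
Proof. by move=> /WN; rewrite opprB. Qed.

Lemma tensor_scale1 (x : M) (c : completion p) :
  bc_class (to_completion p) [:: (x, c)] = c *: unit_tensor x.
Proof.
by rewrite -[RHS]/(bc_scale _ _) bc_scaleE /= mulr1.
Qed.

Lemma tensor_cons (u : M * completion p) s : bc_class (to_completion p) (u :: s) =
  bc_class (to_completion p) [:: u] + bc_class (to_completion p) s.
Proof. by rewrite -[RHS]/(bc_add _ _) bc_addE. Qed.

Lemma level_mapD x y : W (level_map (x + y) - (level_map x + level_map y)).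
Proof.
rewrite /level_map.
have -> : unit_tensor (x + y) = unit_tensor x + unit_tensor y.
  by rewrite -tensor_cons; apply/bc_classP/Tensor_addl.
by rewrite linearD; apply: bc_evalD.
Qed.

Lemma level_mapZ a x : W (level_map (a *: x) - a *: level_map x).
Proof.
rewrite /level_map.
have -> : unit_tensor (a *: x) = to_completion p a *: unit_tensor x.
  rewrite -tensor_scale1; apply/bc_classP.
  by apply: Tensor_trans (Tensor_scale _ _ _ _) _; rewrite mulr1; apply: Tensor_refl.
rewrite linearZ; apply: (Wtrans (bc_evalZ W0 WD WZ Wn _ _)).
by rewrite -scalerBl; apply/Wn/repr_to_completion.
Qed.

(** Evaluation intertwines g with its level map. Hence inverse isomorphisms have level maps that are
    inverse modulo the absorbing submodule. *)
Lemma level_map_eval z : W (ev (g z) - level_map (ev z)).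
Proof.
suff H s : W (ev (g (bc_class (to_completion p) s)) - level_map (lift_eval (fun=> n) s)).
  by rewrite -{1}(bc_class_repr z); apply: H.
elim: s => [|[x c] s IHs].
  rewrite -[bc_class _ [::]]/(0 : base_change (to_completion p) M) linear0.
  rewrite /lift_eval big_nil; apply: (Wtrans (y := 0)).
    have := bc_evalZ W0 WD WZ Wn 0 0; rewrite scaler0 => /Wtrans; apply.
    by rewrite subr0; apply: Wn; rewrite -[repr (0 : completion p) n]subr0; apply: (repr_to_completion p 0).
  by apply: Wsym; have := level_mapZ 0 0; rewrite !scale0r.
rewrite tensor_cons linearD; apply: (Wtrans (bc_evalD W0 WD WN Wnu _ _)).
rewrite /lift_eval big_cons /=; apply: Wsym; apply: (Wtrans (level_mapD _ _)).
rewrite opprD addrACA; apply: WD; last exact: Wsym.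
apply: (Wtrans (level_mapZ _ _)); apply: Wsym.
by rewrite tensor_scale1 linearZ; apply: bc_evalZ.
Qed.

End CompletionMaps.

Lemma level_mapK (A : comPzRingType) (p : max_ideal A) n (M N : lmodType A)
    (V : set M) (g : {linear base_change (to_completion p) M -> base_change (to_completion p) N})
    (h : {linear base_change (to_completion p) N -> base_change (to_completion p) M}) x :
  absorbing p n V -> cancel g h ->
  V (level_map n h (level_map n g x) - x).
Proof.
move=> absV gK; have [V0 VD VZ Vn] := absV.
have VN y : V y -> V (- y) by rewrite -scaleN1r; apply: VZ.
have := level_map_eval absV h (g (bc_class (to_completion p) [:: (x, 1)])).
rewrite gK => /VN; rewrite opprB => Vh.
rewrite -(subrKA (bc_eval (fun=> n) (bc_class (to_completion p) [:: (x, 1)]))).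
apply: (VD) => //; apply: (bc_eval1 V0 VD VN) => y m a nm /(ideal_pow_sub (max_ideal_ideal p) nm).
exact: Vn.
Qed.

Lemma det_congr (A : comNzRingType) (I : set A) k (C D : 'M[A]_k) : is_ideal I ->
  (forall i j, I (C i j - D i j)) -> I (\det C - \det D).
Proof.
case=> I0 ID IM CD; rewrite /determinant.
have IN x : I x -> I (- x) by rewrite -mulN1r; apply: IM.
apply: (big_ind2 (fun x y => I (x - y))); first by rewrite subrr.
  by move=> x x' y y' xx' yy'; rewrite opprD addrACA; apply: ID.
move=> s _; rewrite -mulrBr; apply: (IM).
apply: (big_ind2 (fun x y => I (x - y))); first by rewrite subrr.
  move=> x x' y y' xx' yy'; rewrite -(subrKA (x * y')) -mulrBr -mulrBl.
  by apply: (ID); first exact: (IM); rewrite mulrC; apply: IM.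
by move=> i _; apply: CD.
Qed.

Lemma map_poly_MXaddC_horner (A B : comNzRingType) (v : {rmorphism A -> B})
    (f : {poly A}) r u :
  (map_poly v (f * 'X + r%:P)).[u] = (map_poly v f).[u] * u + v r.
Proof. by rewrite rmorphD rmorphM /= map_polyX map_polyC hornerMXaddC. Qed.

Section LocalTheory.
Variables (Z : idomainType) (dedZ : dedekind_domain Z) (K : comAlgType {fraction Z}).
Variables (S : Zorder K) (p : max_ideal (order_ring S)).
Implicit Types (a d : Z) (x y : K) (r : order_ring S) (I J : frac_ideal S).

Definition inside : set K := [set val r | r in (p : set _)].
Definition outside : set K := [set val r | r in ~` (p : set _)].

Lemma outside_order x : outside x -> Zorder_set S x.
Proof. by move=> [r _ <-]; apply: order_valP. Qed.

Lemma outside1 : outside 1.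
Proof. by exists 1; [apply: max_ideal1 | rewrite rmorph1]. Qed.

Lemma outsideM x y : outside x -> outside y -> outside (x * y).
Proof.
move=> [r pr <-] [r' pr' <-]; exists (r * r'); last by rewrite rmorphM.
exact: notin_max_idealM.
Qed.

Lemma outside_inside x : outside x -> ~ inside x.
Proof. by move=> [r pr <-] [r' pr' /val_inj e]; apply: pr; rewrite -e. Qed.

Lemma notin_inside x : Zorder_set S x -> ~ inside x -> outside x.
Proof. by move=> Sx px; exists (to_order Sx) => // pr; apply: px; exists (to_order Sx). Qed.

Lemma insideM x y : Zorder_set S x -> inside y -> inside (x * y).
Proof.
move=> Sx [r pr <-]; exists (to_order Sx * r); first exact: max_idealM.
by rewrite rmorphM.
Qed.

Lemma insideD x y : inside x -> inside y -> inside (x + y).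
Proof.
move=> [r pr <-] [r' pr' <-]; exists (r + r'); first exact: max_idealD.
by rewrite rmorphD.
Qed.

Lemma inside0 : inside 0.
Proof. by exists 0; [apply: max_ideal0 | rewrite rmorph0]. Qed.

Lemma fiD I x y : I x -> I y -> I (x + y).
Proof. exact: is_latticeD (fi_lattice I). Qed.
Lemma fi0 I : I 0. Proof. exact: is_lattice0 (fi_lattice I). Qed.
Lemma fiN I x : I x -> I (- x). Proof. exact: is_latticeN (fi_lattice I). Qed.

Lemma fi_valP I (x : fi_module I) : I (val x : K).
Proof. exact/set_mem/(valP x). Qed.

Definition to_fi I x (Ix : I x) : fi_module I :=
  FiModule (mem_set Ix : (x : ambient_type S) \in fi_pred I).

Section ColonMap.
Variables (I J : frac_ideal S) (b : K) (Jb : colon J I b).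

Definition colon_map (x : fi_module I) : fi_module J := to_fi (Jb (fi_valP x)).

Lemma colon_map_linear : linear colon_map.
Proof.
move=> r x y; apply: val_inj.
by rewrite linearP /= mulrDr -[r *: _]/(val r * _) -[r *: _ in RHS]/(val r * _) mulrCA.
Qed.
HB.instance Definition _ := GRing.isLinear.Build _ _ _ _ colon_map colon_map_linear.
End ColonMap.

(** An isomorphism of the localizations at p with denominators cleared: multiplication by b, with
    inverse a / (ab). *)
Definition mul_equiv I J :=
  exists a b : K, [/\ colon I J a, colon J I b & outside (a * b)].

Lemma mul_equiv_p_equivalent I J : mul_equiv I J -> p_equivalent p I J.
Proof.
move=> [a [b [Ia Jb [s ps sab]]]]; have [c sc] := to_completion_unit ps.
have cs : c * to_completion p s = 1 by rewrite mulrC.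
exists (bc_map (f := to_completion p) (colon_map Jb)).
exists (fun z => c *: bc_map (f := to_completion p) (colon_map Ia) z) => z.
  rewrite (bc_map_scale (a := s)) ?scalerA ?cs ?scale1r // => x; apply: val_inj.
  by rewrite linearZ /= mulrA -sab.
rewrite linearZ /= (bc_map_scale (a := s)) ?scalerA ?cs ?scale1r // => x; apply: val_inj.
by rewrite linearZ /= mulrA [b * a]mulrC -sab.
Qed.

Definition ideal_pow_mul n (X : set K) : set K := mulset (val @` ideal_pow p n) X.

Lemma mulset_absorb (I : set (order_ring S)) J x : mulset (val @` I) J x -> J x.
Proof.
move: x; apply: mulset_ind; [exact: fi0 | by move=> *; apply: fiD|].
by move=> _ y [r _ <-] Jy; apply: fi_scale => //; apply: order_valP.
Qed.

Lemma mulset_fi_scale (X : set K) J x y : Zorder_set S x -> mulset X J y ->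
  mulset X J (x * y).
Proof. by move=> Sx; apply: mulsetMr => z; apply: fi_scale. Qed.

Lemma mulset_fiN (X : set K) J y : mulset X J y -> mulset X J (- y).
Proof.
rewrite -mulN1r; apply: mulset_fi_scale.
by apply: (is_latticeN (Zorder_lattice S)); apply: order1.
Qed.

Lemma ideal_pow_mul_absorbing n J :
  absorbing p n ([set x | ideal_pow_mul n J (val x)] : set (fi_module J)).
Proof.
split=> [|x y|r x|x r] /=.
- exact: mulset0.
- exact: mulsetD.
- by apply: mulset_fi_scale; apply: order_valP.
- by move=> pr; apply: mulsetM; [exists r | apply: fi_valP].
Qed.

(* Dividing h (d) by an integer d of I gives the multiplier; the denominators
   introduced are absorbed by s p^n <= D S, where D is an integer with
   D I contained in d S. *)
Lemma approx_linear_colon I J : exists N s, outside s /\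
  forall n (h : fi_module I -> fi_module J), (N <= n)%N ->
    (forall r (x : fi_module I), ideal_pow_mul n J (val (h (r *: x) - r *: h x))) ->
    exists b, colon J I b /\
      forall x : fi_module I, mulset inside J (b * val x - s * val (h x)).
Proof.
have [d [d0 Id]] := is_lattice_Zemb (fi_lattice I).
have [e [e0 eI]] := lattice_denom (Zorder_lattice S) (fi_lattice I).
have [s [n0 [ps sn0]]] := order_max_pow dedZ p (mulf_neq0 d0 e0).
(* The strict inequality matters: n0 powers of p pay for the division by de, and the one that is
   left puts the quotient in pJ rather than in J. *)
have absorb n w : (n0 < n)%N -> ideal_pow_mul n J w ->
    exists v, mulset inside J v /\ val s * w = Zemb K (d * e) * v.
  move=> n0n; move: w; apply: mulset_ind.
  - by exists 0; rewrite !mulr0; split=> //; apply: mulset0.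
  - move=> w w' [v [Jv wv]] [v' [Jv' wv']]; exists (v + v').
    by rewrite !mulrDr wv wv'; split=> //; apply: mulsetD.
  move=> _ j [r /(ideal_pow_sub (max_ideal_ideal p) n0n) pr <-] Jj.
  move: r pr; apply: mulset_ind.
  - by exists 0; rewrite rmorph0 mul0r !mulr0; split=> //; apply: mulset0.
  - move=> w w' [v [Jv wv]] [v' [Jv' wv']]; exists (v + v').
    by rewrite rmorphD mulrDl !mulrDr wv wv'; split=> //; apply: mulsetD.
  move=> r r' pr /sn0[z /(congr1 val)]; rewrite !rmorphM /= => srz.
  exists (val r * (val z * j)); split.
    apply: mulsetM; first by exists r.
    by apply: fi_scale => //; apply: order_valP.
  have -> : val s * (val r * val r' * j) = val s * val r' * (val r * j) by ring.
  by rewrite srz ZembM /=; ring.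
exists n0.+1, (val s); split=> [|n h n0n hlin]; first by exists s.
pose delta := to_fi Id.
have [b sb] := Zemb_divr (val s * val (h delta)) d0.
have bh (x : fi_module I) : mulset inside J (b * val x - val s * val (h x)).
  (* Here r = ex lies in S and r d = (de) x. Computing h of this element in two ways shows that de
     (b x - s h(x)) lies in s p^n J. *)
  pose r := to_order (eI _ (fi_valP x)).
  have rx : r *: delta = Zorder_emb S (d * e) *: x.
    apply: val_inj; rewrite !linearZ /= -[LHS]/(Zemb K e * val x * Zemb K d).
    by rewrite -[RHS]/(Zemb K (d * e) * val x) ZembM; ring.
  have hr : ideal_pow_mul n J
    ((val (h (r *: delta)) : K) - Zemb K e * val x * val (h delta)) := hlin r delta.
  have hd : ideal_pow_mul n J
    ((val (h (r *: delta)) : K) - Zemb K (d * e) * val (h x)).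
    by rewrite rx; apply: hlin.
  have [v [Jv sv]] := absorb _ _ n0n (mulsetD hd (mulset_fiN hr)).
  have -> : b * val x - val s * val (h x) = v; last exact: Jv.
  apply: (Zemb_inj (mulf_neq0 d0 e0)); rewrite -sv.
  have -> : Zemb K (d * e) * (b * val x - val s * val (h x)) =
    Zemb K e * val x * (Zemb K d * b) - Zemb K (d * e) * val s * val (h x).
    by rewrite ZembM; ring.
  by rewrite -sb /=; ring.
exists b; split=> // x Ix.
rewrite -[b * x](subrK (val s * val (h (to_fi Ix)))); apply: fiD.
  by have := bh (to_fi Ix); apply: mulset_absorb.
by apply: fi_scale; [apply: order_valP | apply: fi_valP].
Qed.

(** On generators of I, u acts by a matrix C congruent to the scalar t modulo p. The constant
    coefficient r of its characteristic polynomial fX + r is, up to sign, det C, congruent to a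
    power of t up to sign and hence outside p. Since f(u)u + r = 0, the witness is w = -f(u), which
    preserves I as u does. *)
Lemma nakayama_colon I u t : colon I I u -> outside t ->
  (forall x, I x -> mulset inside I (u * x - t * x)) ->
  exists w, colon I I w /\ outside (u * w).
Proof.
move=> Iu [t' pt' <-] ut; have [[s Is] _] := fi_lattice I.
have comb x : mulset inside I x -> exists c : nat -> order_ring S,
    (forall i, p (c i)) /\ x = \sum_(i < size s) val (c i) * s`_i.
  move: x; apply: mulset_ind.
  - exists (fun=> 0); split=> [i|]; first exact: max_ideal0.
    by rewrite big1 // => i _; rewrite rmorph0 mul0r.
  - move=> x y [c [pc ->]] [c' [pc' ->]]; exists (fun i => c i + c' i).
    split=> [i|]; first exact: max_idealD.
    by rewrite -big_split; apply: eq_bigr => i _; rewrite rmorphD mulrDl.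
  move=> _ y [r pr <-]; rewrite Is => -[c ->]; exists (fun i => Zorder_emb S (c i) * r).
  split=> [i|]; first exact: max_idealM.
  rewrite mulr_sumr; apply: eq_bigr => i _; rewrite ZscaleE rmorphM /=.
  by rewrite mulrA [val r * _]mulrC.
have sI i : (i < size s)%N -> I s`_i.
  by move=> si; rewrite Is; apply: Zspan_mem; apply: mem_nth.
have /choice[c cP] (i : 'I_(size s)) := comb _ (ut _ (sI i (ltn_ord i))).
pose C : 'M_(size s) := \matrix_(i, j) (t' *+ (i == j) + c i j).
have zero : forall j : 'I_(size s), (map_poly val (char_poly C)).[u] * s`_j = 0.
  apply: det_trick => i; rewrite -[LHS](subrK (val t' * s`_i)) (proj2 (cP i)).
  rewrite [RHS](eq_bigr (fun j : 'I_(size s) => val (c i j) * s`_j +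
     (val t' *+ (i == j)) * s`_j)).
    rewrite big_split /=; congr (_ + _); rewrite (bigD1 i) //= eqxx mulr1n big1 ?addr0 //.
    by move=> j /negPf ji; rewrite eq_sym ji mulr0n mul0r.
  by move=> j _; rewrite mxE rmorphD rmorphMn addrC mulrDl.
(* The value kills the generators of I, hence a nonzero integer d in I, which can be cancelled in
   K. *)
have qu0 : (map_poly val (char_poly C)).[u] = 0.
  have [d [d0]] := is_lattice_Zemb (fi_lattice I); rewrite Is => -[e de].
  apply: (Zemb_inj d0); rewrite mulr0 mulrC de mulr_sumr big1 // => j _.
  by rewrite ZscaleE mulrCA zero mulr0.
have horner_colon (f : {poly order_ring S}) : colon I I (map_poly val f).[u].
  elim/poly_ind: f => [|f r IHf] x Ix; first by rewrite rmorph0 horner0 mul0r; apply: fi0.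
  rewrite map_poly_MXaddC_horner mulrDl; apply: fiD.
    by rewrite -mulrA; apply/IHf/Iu.
  by apply: fi_scale => //; apply: order_valP.
have [f [r fr]] : exists (f : {poly order_ring S}) r, char_poly C = f * 'X + r%:P.
  elim/poly_ind: (char_poly C) => [|f r _]; last by exists f, r.
  by exists 0, 0; rewrite mul0r addr0.
have pr : ~ p r.
  have -> : r = (-1) ^+ size s * \det C.
    by rewrite -char_poly_det fr coefD coefMX coefC /= add0r.
  have pI := max_ideal_ideal p.
  have p1 : ~ p (- 1).
    by move=> /(ideal_oppr pI); rewrite opprK; apply: max_ideal1.
  move=> /max_ideal_prime[/(notin_max_idealX p1)//|].
  have /(ideal_oppr pI) : p (\det C - \det (t'%:M : 'M_(size s))).
    apply: (det_congr pI) => i j; rewrite !mxE addrAC subrr add0r.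
    by case: (cP i).
  rewrite opprB det_scalar => pB /(max_idealD pB); rewrite subrK.
  exact: notin_max_idealX.
exists (- (map_poly val f).[u]); split.
  by move=> x Ix; rewrite mulNr; apply/fiN/horner_colon.
exists r => //; apply/eqP; rewrite mulrN -subr_eq0 opprK; apply/eqP.
by move: qu0; rewrite fr map_poly_MXaddC_horner addrC [_ * u]mulrC.
Qed.

Lemma p_equivalent_mul_equiv I J : p_equivalent p I J -> mul_equiv I J.
Proof.
move=> [g [g' gK g'K]].
have g'lin : linear g' by apply: can2_linear gK g'K.
pose hL := GRing.isLinear.Build _ _ _ _ g' g'lin.
pose h : {linear fi_completion p J -> fi_completion p I} := HB.pack g' hL.
have [N [s [os sP]]] := approx_linear_colon I J.
have [N' [s' [os' sP']]] := approx_linear_colon J I.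
(* The successor makes n positive, whence p^n I <= pI. *)
pose n := (maxn N N').+1.
have [|r x|b [Jb bP]] := sP n (level_map n g).
- by rewrite /n leqW // leq_maxl.
- exact: level_mapZ (ideal_pow_mul_absorbing n J) g r x.
have [|r x|a [Ia aP]] := sP' n (level_map n h).
- by rewrite /n leqW // leq_maxr.
- exact: level_mapZ (ideal_pow_mul_absorbing n I) h r x.
have pn : ideal_pow_mul n I `<=` mulset inside I.
  apply: mulset_ind; [exact: mulset0 | exact: mulsetD|].
  move=> _ y [r pr <-] Iy; apply: mulsetM => //; exists r => //.
  have := ideal_pow_sub (max_ideal_ideal p) (isT : (1 <= n)%N) pr.
  apply: mulset_ind; [exact: max_ideal0 | exact: max_idealD|].
  by move=> x z px _; apply: max_idealMr.
have Iab : colon I I (a * b) by move=> x Ix; rewrite -mulrA; apply/Ia/Jb.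
have [|w [Iw ow]] := nakayama_colon Iab (outsideM os os').
  move=> x Ix; pose y := level_map n g (to_fi Ix); pose z := level_map n h y.
  (* The three errors are that of b against g, that of a against h, and that of the round trip
     through the two level maps; each lies in pI. *)
  have -> : a * b * x - s * s' * x = a * (b * x - s * val y) +
     s * (a * val y - s' * val z) + s * s' * (val z - x).
    by ring.
  apply: mulsetD; first apply: mulsetD.
  - have := bP (to_fi Ix); rewrite -/y /=; move: (_ - _).
    apply: mulset_ind => [|v v'|r j pr Jj].
    + by rewrite mulr0; apply: mulset0.
    + by rewrite mulrDr; apply: mulsetD.
    + by rewrite mulrCA; apply: mulsetM => //; apply: Ia.
  - by apply: mulset_fi_scale; [apply: outside_order | apply: aP].
  - apply: mulset_fi_scale; first by apply: orderM; apply: outside_order.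
    apply: pn; have hK : cancel g h := gK.
    exact: (level_mapK (to_fi Ix) (ideal_pow_mul_absorbing n I) hK).
exists a, (b * w); split=> //; last by rewrite mulrA.
by move=> x Ix; rewrite -mulrA; apply/Jb/Iw.
Qed.

Lemma p_equivalentP I J : p_equivalent p I J <-> mul_equiv I J.
Proof. by split; [apply: p_equivalent_mul_equiv | apply: mul_equiv_p_equivalent]. Qed.

Lemma common_multiplier (Y : set K) (l : seq K) : Y 0 ->
  (forall x y, Y x -> Y y -> Y (x + y)) ->
  (forall x y, Zorder_set S x -> Y y -> Y (x * y)) ->
  (forall x, Zspan l x -> exists t, outside t /\ Y (t * x)) ->
  exists t, outside t /\ forall x, Zspan l x -> Y (t * x).
Proof.
move=> Y0 YD YM; elim: l => [|y l IHl] Vx.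
  exists 1; split; first exact: outside1.
  by move=> x; rewrite Zspan_nil => ->; rewrite mulr0.
have [|s [os sl]] := IHl.
  by move=> x lx; apply: Vx; apply/Zspan_consP; exists 0, x; rewrite Zscale0l add0r.
have [|t [ot ty]] := Vx y; first by apply: Zspan_mem; rewrite inE eqxx.
exists (s * t); split; first exact: outsideM.
move=> _ /Zspan_consP[a [z [/sl sz ->]]]; rewrite mulrDr; apply: YD.
  rewrite ZscaleE mulrCA; apply: (YM); first exact: order_Zemb.
  by rewrite -mulrA; apply: YM => //; apply: outside_order.
by rewrite [s * t]mulrC -mulrA; apply: YM => //; apply: outside_order.
Qed.

(** The set V of the proof is the localization of S at p inside K. Each vector of K is carried into
    V by some power of p, which is its level [nu]. Evaluating x (x) 1 modulo V gives x, while
    evaluating a formal sum over S gives an element of S, so x lies in V; a common multiplier then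
    exists because X is finitely generated. *)
Lemma local_span_order_sub X : (exists l, X = Zspan l) ->
  local_span p X `<=` local_span p S ->
  exists s, outside s /\ forall x, X x -> Zorder_set S (s * x).
Proof.
move=> [l Xl] XS.
pose V : set (ambient_type S) := [set y | exists t, outside t /\ Zorder_set S (t * (y : K))].
have V0 : V 0.
  exists 1; rewrite mulr0; split; first exact: outside1.
  exact: is_lattice0 (Zorder_lattice S).
have VD x y : V x -> V y -> V (x + y).
  move=> [t [ot tx]] [t' [ot' ty]]; exists (t * t'); split; first exact: outsideM.
  have -> : t * t' * ((x : K) + y) = t' * (t * (x : K)) + t * (t' * (y : K)) by ring.
  by apply: orderD; apply: orderM => //; apply: outside_order.
have VN x : V x -> V (- x).
  by move=> [t [ot tx]]; exists t; rewrite mulrN; split=> //; apply: is_latticeN (Zorder_lattice S) tx.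
have Sv y : Zorder_set S y -> V y by exists 1; rewrite mul1r; split=> //; apply: outside1.
have /choice[nu nuP] (x : ambient_type S) : exists n, forall m r,
    (n <= m)%N -> ideal_pow p m r -> V (r *: x).
  have [d [d0 dx]] := Zspan_denom [:: (x : K)] (Zorder_lattice S).
  have [s [n [ps sn]]] := order_max_pow dedZ p d0; exists n => m r nm.
  move=> /(ideal_pow_sub (max_ideal_ideal p) nm)/sn[z /(congr1 val)]; rewrite !rmorphM /= => srz.
  exists (val s); split; first by exists s.
  rewrite -[r *: x]/(val r * (x : K)) mulrA srz mulrAC mulrC; apply: orderM.
    exact: order_valP.
  by apply: dx; apply: Zspan_mem; rewrite inE.
have Vx x : X x -> V x.
  move=> Xx; have : local_span p S (bc_class (to_completion p) [:: (x : ambient_type S, 1)]).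
    by apply: XS; exists [:: (x : ambient_type S, 1)] => // u; rewrite inE => /eqP->.
  move=> [t tS tx].
  have Vev := bc_eval1 V0 VD VN nuP x; have Vt := bc_evalE V0 VD VN nuP t.
  rewrite tx in Vt.
  have Vl : V (lift_eval nu t).
    apply: Sv; rewrite /lift_eval big_seq; elim/big_ind: _.
    - exact: is_lattice0 (Zorder_lattice S).
    - by move=> y z; apply: orderD.
    - by move=> u /tS Su; apply: orderM => //; apply: order_valP.
  have := VD _ _ (VD _ _ (VN _ Vev) Vt) Vl.
  by rewrite opprB subrKA subrK.
rewrite Xl in Vx *; apply: (common_multiplier (Y := S)) Vx.
- exact: is_lattice0 (Zorder_lattice S).
- by move=> x y; apply: orderD.
- by move=> x y; apply: orderM.
Qed.

Lemma sub_local_span_order X s : outside s ->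
  (forall x, X x -> Zorder_set S (s * x)) -> local_span p X `<=` local_span p S.
Proof.
move=> [r pr <-] sX _ [t tX <-]; have [c rc] := to_completion_unit pr.
exists [seq ((val r * (u.1 : K) : ambient_type S), c * u.2) | u <- t].
  by move=> _ /mapP[u /tX Xu ->]; apply: sX.
elim: t {tX} => [//|[x b] t IHt] /=; rewrite -cat1s -[in RHS]cat1s -!bc_addE; congr bc_add => //.
apply/bc_classP; apply: Tensor_trans (Tensor_scale _ r x (c * b)) _.
by rewrite mulrA rc mul1r; apply: Tensor_refl.
Qed.

End LocalTheory.

(** * Maximal orders and extension of ideals *)

Section MaximalOrder.
Variables (Z : idomainType) (dedZ : dedekind_domain Z) (K : comAlgType {fraction Z}).
Implicit Types (a d : Z) (S : Zorder K).

Lemma colon_order S (I : frac_ideal S) : exists T : Zorder K, T = colon I I :> set K.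
Proof.
have latI := fi_lattice I.
have sub : [/\ colon I I 1, forall x y, colon I I x -> colon I I y -> colon I I (x - y) &
    forall x y, colon I I x -> colon I I y -> colon I I (x * y)].
  split=> [x|x y Ix Iy z Iz|x y Ix Iy z Iz]; first by rewrite mul1r.
    by rewrite mulrBl; apply: fiD; [apply: Ix | apply/fiN/Iy].
  by rewrite -mulrA; apply/Ix/Iy.
have SI : S `<=` colon I I by move=> x Sx y; apply: fi_scale.
suff lat : is_lattice (colon I I) by exists (ZOrder sub lat).
have [d [d0 Id]] := is_lattice_Zemb latI; have [[s Is] _] := latI; split; last first.
  have [_ [k [b [bbasis bS]]]] := Zorder_lattice S.
  by exists k, b; split=> // i; apply/SI/bS.
have Imod : is_Zsubmodule (colon I I).
  split=> [|x y Ix Iy z Iz|a x Ix z Iz].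
  - by move=> x _; rewrite mul0r; apply: fi0.
  - by rewrite mulrDl; apply: fiD; [apply: Ix | apply: Iy].
  - by rewrite ZscaleE -mulrA; apply: is_latticeZ => //; apply: Ix.
(* An element of (I:I) sends the integer d of I into I, so (I:I) lies in d^-1 I. *)
apply: (Zspan_noetherian dedZ Imod (s := [seq (tofrac d)^-1 *: x | x <- s])).
move=> x /(_ _ Id); rewrite Is => -[c xc]; exists c.
apply: (Zemb_inj d0); rewrite mulrC xc size_map mulr_sumr; apply: eq_bigr => i _.
rewrite (nth_map 0) // !ZscaleE mulrCA -[Zemb K d * _]ZscaleE /Zscale.
by rewrite scalerA divff ?tofrac_eq0 // scale1r.
Qed.

Variables (O : Zorder K) (maxO : is_maximal_order O).

Lemma colon_sub_maximal S (I : frac_ideal S) : colon I I `<=` O.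
Proof. by have [T <-] := colon_order I; apply: maxO. Qed.

Lemma order_ideal_frac S (A : set (order_ring S)) d : is_ideal A -> d != 0 ->
  A (Zorder_emb S d) -> exists I : frac_ideal S, I = val @` A :> set K.
Proof.
move=> AI d0 Ad; have [A0 AD AM] := AI.
have scale x y : Zorder_set S x -> (val @` A) y -> (val @` A) (x * y).
  move=> Sx [r Ar <-]; exists (to_order Sx * r); first exact: AM.
  by rewrite order_valM.
suff lat : is_lattice (val @` A) by exists (FracIdeal scale lat).
apply: (sub_is_lattice dedZ _ d0 (Y := S)).
- split=> [|x y [r Ar <-] [r' Ar' <-]|a x Ax].
  + by exists 0; rewrite ?order_val0.
  + by exists (r + r'); [apply: AD | rewrite order_valD].
  + by rewrite ZscaleE; apply: scale => //; apply: order_Zemb.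
- by move=> y Sy; rewrite mulrC; apply: scale => //; exists (Zorder_emb S d).
- by move=> _ [r _ <-]; apply: order_valP.
- exact: Zorder_lattice.
Qed.

(** Take m + 1 minimal among the n such that s q^n <= dS for some s outside q; n = 0 is impossible,
    as s would lie in dS <= q. Then c = sr/d, where r is in q^m and sr is not in dS. *)
Lemma max_ideal_colon_notin S (q : max_ideal (order_ring S)) d : d != 0 ->
  q (Zorder_emb S d) ->
  exists c, ~ Zorder_set S c /\ forall r, q r -> Zorder_set S (c * val r).
Proof.
move=> d0 qd.
pose P n := `[< exists s, ~ q s /\
  forall r, ideal_pow q n r -> exists z, s * r = Zorder_emb S d * z >].
have exP : exists n, P n.
  have [s [n [qs sn]]] := order_max_pow dedZ q d0.
  by exists n; apply/asboolP; exists s.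
case: (ex_minnP exP) => -[|m] /asboolP[s [qs sP]] Pmin.
  have [//|z] := sP 1; rewrite mulr1 => sz.
  by case: qs; rewrite sz; apply: max_idealMr.
have /existsNP[r /not_implyP[qr rz]] :
    ~ forall r, ideal_pow q m r -> exists z, s * r = Zorder_emb S d * z.
  by move=> h; have : P m by [apply/asboolP; exists s]; move=> /Pmin; rewrite ltnn.
have [c sr] := Zemb_divr (val s * val r) d0; exists c; split=> [Sc|x qx].
  by apply: rz; exists (to_order Sc); apply: val_inj; rewrite !order_valM.
have [|z] := sP (x * r); first exact: mulsetM.
move=> /(congr1 val); rewrite !order_valM /= => sz.
have -> : c * val x = val z; last exact: order_valP.
apply: (Zemb_inj d0); rewrite mulrA -sr -[RHS]sz /=; ring.
Qed.

(** Noetherian induction. For A inside a maximal ideal q and c as above, B = A + cA lies in O and is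
    larger than A, since otherwise c would be in (A:A) <= O. If e is in (O:B), then e and ce are in
    (O:A), so a relation showing B invertible becomes one for A. The integer d stays in all these
    ideals and keeps them lattices. *)
Lemma maximal_order_ideal_invertible (A : set (order_ring O)) d : d != 0 -> is_ideal A ->
  A (Zorder_emb O d) -> mulset (val @` A) (colon O (val @` A)) 1.
Proof.
move=> d0; move: A; apply: (noetherian_ind (order_noetherian dedZ (S := O))) => A AI IHA Ad.
have [A1|A1] := pselect (A 1).
  rewrite -[1]mulr1; apply: mulsetM; first by exists 1; rewrite ?order_val1.
  by move=> _ [r _ <-]; rewrite mul1r; apply: order_valP.
have [q Aq] := noetherian_max_ideal (order_noetherian dedZ (S := O)) AI A1.
have [c [Oc cq]] := max_ideal_colon_notin d0 (Aq _ Ad).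
have [A0 AD AM] := AI.
pose B : set (order_ring O) :=
  [set r | exists x y, [/\ A x, A y & val r = val x + c * val y]].
have BI : is_ideal B.
  split; first by exists 0, 0; rewrite order_val0 mulr0 addr0.
  - move=> r r' [x [y [Ax Ay rE]]] [x' [y' [Ax' Ay' rE']]]; exists (x + x'), (y + y').
    by rewrite !order_valD rE rE' mulrDr addrACA; split=> //; apply: AD.
  - move=> z r [x [y [Ax Ay rE]]]; exists (z * x), (z * y).
    by rewrite !order_valM rE mulrDr mulrCA; split=> //; apply: AM.
have AB : A `<=` B by move=> x Ax; exists x, 0; rewrite order_val0 mulr0 addr0.
have cB r : A r -> (val @` B) (c * val r).
  move=> Ar; exists (to_order (cq _ (Aq _ Ar))) => //.
  by exists 0, r; rewrite order_val0 add0r.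
have BA : B <> A.
  move=> BA; have [I IA] := order_ideal_frac AI d0 Ad; apply: Oc.
  apply: (@colon_sub_maximal _ I); rewrite IA => _ [r Ar <-].
  by have := cB r Ar; rewrite BA.
have := IHA B BI AB BA (AB _ Ad); apply: mulset_ind; [exact: mulset0 | exact: mulsetD|].
move=> _ e [r [x [y [Ax Ay rE]]] <-] eB.
rewrite rE mulrDl [c * _]mulrC -mulrA; apply: mulsetD; apply: mulsetM.
- by exists x.
- by move=> _ [z Az <-]; apply: eB; exists z => //; apply: AB.
- by exists y.
- by move=> _ [z Az <-]; rewrite mulrAC mulrC; apply/eB/cB.
Qed.

Lemma maximal_order_invertible (M : frac_ideal O) : mulset M (colon O M) 1.
Proof.
have [d [d0 Md]] := lattice_denom (Zorder_lattice O) (fi_lattice M).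
have [e [e0 Me]] := is_lattice_Zemb (fi_lattice M).
pose A : set (order_ring O) := [set r | exists2 m, M m & val r = Zemb K d * m].
have AI : is_ideal A.
  split; first by exists 0; [apply: fi0 | rewrite order_val0 mulr0].
  - move=> r r' [m Mm rm] [m' Mm' rm']; exists (m + m'); first exact: fiD.
    by rewrite order_valD rm rm' mulrDr.
  - move=> z r [m Mm rm]; exists (val z * m); last by rewrite order_valM rm mulrCA.
    by apply: fi_scale => //; apply: order_valP.
have Ade : A (Zorder_emb O (d * e)) by exists (Zemb K e) => //; rewrite -ZembM.
have := maximal_order_ideal_invertible (mulf_neq0 d0 e0) AI Ade.
apply: mulset_ind; [exact: mulset0 | exact: mulsetD|].
move=> _ y [r [m Mm rm] <-] Oy; rewrite rm mulrAC mulrC; apply: mulsetM => // m' Mm'.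
rewrite mulrAC mulrC; apply: Oy.
by exists (to_order (Md _ Mm')) => //; exists m'.
Qed.

(** Regroup (M M^-1)(N N^-1) as (M N^-1)(N M^-1). *)
Lemma maximal_order_colon_mul (M N : frac_ideal O) : mulset (colon M N) (colon N M) 1.
Proof.
suff H v w : mulset M (colon O M) v -> mulset N (colon O N) w ->
    mulset (colon M N) (colon N M) (v * w).
  by rewrite -[1]mulr1; apply: H; apply: maximal_order_invertible.
move=> Mv; move: w; apply: mulset_ind => [|w w'|n z Nn Oz].
- by rewrite mulr0; apply: mulset0.
- by rewrite mulrDr; apply: mulsetD.
move: v Mv; apply: mulset_ind => [|v v'|m y Mm Oy].
- by rewrite mul0r; apply: mulset0.
- by rewrite mulrDl; apply: mulsetD.
have -> : m * y * (n * z) = (m * z) * (n * y) by ring.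
apply: mulsetM => x Nx.
  by rewrite -mulrA mulrC; apply: fi_scale => //; apply: Oz.
by rewrite -mulrA mulrC; apply: fi_scale => //; apply: Oy.
Qed.

(* Where S agrees with O locally, every fractional ideal is locally principal. *)
Lemma mul_equiv_regular S (q : max_ideal (order_ring S)) (I J : frac_ideal S) c :
  outside q c -> (forall x, O x -> Zorder_set S (c * x)) -> mul_equiv q I J.
Proof.
move=> oc cO; pose Q : set K := [set x | inside q (c * x)].
(* 1 is a sum of products ab of multipliers between the extensions to O. Q is closed under sums and
   misses 1, because c is outside q, so one product misses Q. *)
have [a [b [IJa JIb Qab]]] : exists a b : K, [/\ colon (fi_ext O I) (fi_ext O J) a,
    colon (fi_ext O J) (fi_ext O I) b & ~ Q (a * b)].
  apply: contrapT => nab; apply: (outside_inside oc).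
  suff : Q 1 by rewrite /Q /= mulr1.
  move: (maximal_order_colon_mul (fi_ext O I) (fi_ext O J)); move: 1.
  apply: mulset_ind => [|x y Qx Qy|a b Ia Jb]; rewrite /Q /=.
  - by rewrite mulr0; apply: inside0.
  - by rewrite mulrDr; apply: insideD.
  - by apply: contrapT => Qab; apply: nab; exists a, b.
have cext (L : frac_ideal S) x : fi_ext O L x -> L (c * x).
  move: x; apply: mulset_ind => [|x y|x y Lx Oy].
  - by rewrite mulr0; apply: fi0.
  - by rewrite mulrDr; apply: fiD.
  - by rewrite mulrCA mulrC; apply: fi_scale => //; apply: cO.
have subext (L : frac_ideal S) x : L x -> fi_ext O L x.
  by move=> Lx; rewrite -[x]mulr1; apply: mulsetM => //; apply: order1.
exists (c * a), (c * b); split.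
- by move=> x Jx; rewrite -mulrA; apply/cext/IJa/subext.
- by move=> x Ix; rewrite -mulrA; apply/cext/JIb/subext.
have -> : c * a * (c * b) = c * (c * (a * b)) by ring.
apply: outsideM => //; apply: notin_inside => //; apply/cO/(@colon_sub_maximal _ (fi_ext O I)).
by move=> x Ix; rewrite -mulrA; apply/IJa/JIb.
Qed.

End MaximalOrder.

(** * Extension of ideals to an order T that agrees with R at p *)

Section Extension.
Variables (Z : idomainType) (dedZ : dedekind_domain Z) (K : comAlgType {fraction Z}).
Variables (O : Zorder K) (maxO : is_maximal_order O) (R T : Zorder K).
Variables (p : max_ideal (order_ring R)) (m : nat) (s : K).
Hypothesis RT : R `<=` T.
Hypothesis os : outside p s.
Hypothesis sT : forall x, T x -> Zorder_set R (s * x).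
Hypothesis pO : forall r x, p r -> O x -> T (val r ^+ m * x).
Implicit Types (I J : frac_ideal R) (q : max_ideal (order_ring T)).

Lemma sub_fi_ext I x : I x -> fi_ext T I x.
Proof. by move=> Ix; rewrite -[x]mulr1; apply: mulsetM => //; apply: order1. Qed.

Lemma fi_ext_multiplier I x : fi_ext T I x -> I (s * x).
Proof.
move: x; apply: mulset_ind => [|x y|x y Ix Ty].
- by rewrite mulr0; apply: fi0.
- by rewrite mulrDr; apply: fiD.
- by rewrite mulrCA mulrC; apply: fi_scale => //; apply: sT.
Qed.

Lemma colon_fi_ext I J a : colon I J a -> colon (fi_ext T I) (fi_ext T J) a.
Proof.
move=> Ia; apply: mulset_ind => [|x y|x y Jx Ty].
- by rewrite mulr0; apply: mulset0.
- by rewrite mulrDr; apply: mulsetD.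
- by rewrite mulrA; apply: mulsetM => //; apply: Ia.
Qed.

(** If q contains p, then ab is invertible modulo p and so is not in q. Otherwise some r' in p is
    outside q, and r'^m O <= T makes T agree with O at q. *)
Lemma mul_equiv_fi_ext q I J : mul_equiv p I J -> mul_equiv q (fi_ext T I) (fi_ext T J).
Proof.
move=> [a [b [Ia Jb [r pr rab]]]].
have [pq|/existsNP[r' /not_implyP[pr' qr']]] := pselect (forall r', p r' -> inside q (val r')).
  exists a, b; split; [exact: colon_fi_ext | exact: colon_fi_ext | rewrite -rab].
  apply: notin_inside; first exact/RT/order_valP.
  move=> qr; have [r1 [c [pc e]]] := max_ideal_inv pr.
  apply: (outside_inside (outside1 q)).
  have -> : 1 = val r1 * val r + val c.
    by rewrite -order_valM e order_valB order_val1 subrK.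
  apply: insideD; last exact: pq.
  by apply: insideM => //; apply/RT/order_valP.
apply: (mul_equiv_regular dedZ maxO _ _ (c := val r' ^+ m)); last by move=> x; apply: pO.
have : outside q (val r') by apply: notin_inside => //; apply/RT/order_valP.
elim: m => [|n IHn] or'; first by rewrite expr0; apply: outside1.
by rewrite exprS; apply: outsideM => //; apply: IHn.
Qed.

(** Multiplication by s brings T into R without changing anything at p, so t belongs to the maximal
    ideal over p exactly when st is in p. *)
Lemma max_ideal_above : exists q, forall x, T x -> inside q x <-> inside p (s * x).
Proof.
pose q : set (order_ring T) := [set t | inside p (s * val t)].
have Rs := outside_order os.
have qmax : is_maximal_ideal q.
  have qI : is_ideal q.
    split; rewrite /q /=.
    - by rewrite mulr0; apply: inside0.
    - by move=> x y qx qy; rewrite mulrDr; apply: insideD.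
    move=> t x qx; apply: contrapT => /notin_inside otx.
    (* A second factor s splits the product as (st)(sx), with st in R and sx in p. *)
    have : outside p (s * (s * (val t * val x))).
      by apply: outsideM => //; apply: otx; apply/sT/orderM; apply: order_valP.
    have -> : s * (s * (val t * val x)) = s * val t * (s * val x) by ring.
    by move=> /outside_inside; apply; apply: insideM => //; apply/sT/order_valP.
  split=> //; first by rewrite /q /= mulr1; apply: outside_inside.
  move=> J JI qJ; have [Jq|/existsNP[x /not_implyP[Jx qx]]] := pselect (J `<=` q).
    by left; apply/seteqP.
  right; have [J0 JD JM] := JI; apply/seteqP; split=> // z _.
  have [r pr rx] : outside p (s * val x) by apply: notin_inside => //; apply/sT/order_valP.
  have [r1 [c [pc e]]] := max_ideal_inv pr.
  have Tr1 : T (val r1 * s) by apply/RT/orderM => //; apply: order_valP.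
  have J1 : J 1.
    have -> : 1 = to_order Tr1 * x + to_order (RT (order_valP c)).
      apply: val_inj; rewrite order_valD order_valM order_val1 /= -mulrA -[order_val x]/(val x) -rx.
      by rewrite -order_valM e order_valB order_val1 subrK.
    apply: (JD); first exact: JM.
    by apply: qJ; rewrite /q /=; apply: insideM => //; exists c.
  by rewrite -[z]mulr1; apply: JM.
exists (MaxIdeal qmax) => x Tx; split=> [[t qt <-] //|px].
by exists (to_order Tx).
Qed.

Lemma fi_ext_mul_equiv_inj I J :
  (forall q, mul_equiv q (fi_ext T I) (fi_ext T J)) -> mul_equiv p I J.
Proof.
have [q qP] := max_ideal_above; move=> /(_ q)[a [b [Ia Jb oab]]].
exists (s * a), (s * b); split.
- by move=> x Jx; rewrite -mulrA; apply/fi_ext_multiplier/Ia/sub_fi_ext.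
- by move=> x Ix; rewrite -mulrA; apply/fi_ext_multiplier/Jb/sub_fi_ext.
have -> : s * a * (s * b) = s * (s * (a * b)) by ring.
have Tab := outside_order oab.
by apply: outsideM => //; apply: notin_inside; [apply: sT | rewrite -qP //; apply: outside_inside].
Qed.

(** Let x be in (IT:IT). For r = ts, which is outside p, the product rx lies in T. Also x is in O,
    so c^m x is in T for every c in p. A suitable c^m and r generate the unit ideal of R, so x is in
    T. *)
Lemma colon_fi_ext_order I t : outside p t ->
  (forall x, colon I I x -> Zorder_set R (t * x)) ->
  colon (fi_ext T I) (fi_ext T I) = T.
Proof.
move=> ot tI; apply/seteqP; split=> [x xI|x Tx y]; last exact: fi_scale.
have Ox : O x by apply: (colon_sub_maximal dedZ maxO) xI.
have [r pr rE] : outside p (t * s) by apply: outsideM.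
have Trx : T (val r * x).
  rewrite rE -mulrA; apply/RT/tI => y Iy.
  by rewrite -mulrA; apply/fi_ext_multiplier/xI/sub_fi_ext.
have [r1 [c [pc e]]] := max_ideal_inv pr.
(* Starting from 1 = c + r1 r, multiply the relation for n by c and replace the remaining c by 1 -
   r1 r. *)
have [z ez] : exists z, 1 = c ^+ m + z * r.
  elim: m => [|n [z ez]]; first by exists 0; rewrite mul0r addr0.
  exists (r1 + c * z); rewrite exprS mulrDl e addrCA -mulrA -mulrDr -ez mulr1.
  by rewrite subrK.
rewrite -[x]mul1r -(order_val1 R) ez order_valD order_valM order_valX mulrDl.
apply: orderD; first exact: pO.
by rewrite -mulrA; apply: orderM => //; apply/RT/order_valP.
Qed.

(** The maximal ideal of T over p suffices. For x in (I:I), the element abx maps B to IT by a, stays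
    there by x and returns to B by b; so abx is in (B:B) = T, and s brings it into R. *)
Lemma colon_order_of_fi_ext I (B : frac_ideal T) :
  (forall q, mul_equiv q (fi_ext T I) B) -> colon B B = T ->
  exists t, outside p t /\ forall x, colon I I x -> Zorder_set R (t * x).
Proof.
have [q qP] := max_ideal_above; move=> /(_ q)[a [b [Ia Bb oab]]] BT.
have Tab := outside_order oab.
exists (s * (a * b)); split.
  by apply: notin_inside; [apply: sT | rewrite -qP //; apply: outside_inside].
move=> x Ix; rewrite -mulrA; apply: sT; rewrite -BT => y By.
have -> : a * b * x * y = b * (x * (a * y)) by ring.
by apply/Bb/(colon_fi_ext Ix)/Ia.
Qed.

End Extension.

(** * Gluing and the main theorem *)

HB.instance Definition _ (A : comPzRingType) := gen_eqMixin (max_ideal A).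

Section Gluing.
Variables (Z : idomainType) (dedZ : dedekind_domain Z) (K : comAlgType {fraction Z}).
Variable R : Zorder K.
Implicit Types (p q : max_ideal (order_ring R)).

(** A substitute for the Chinese remainder theorem: u is a unit at p and divisible by d at the other
    members of F. It is a product of powers r^n with r in q but not in p. *)
Lemma avoid_other_max_ideals p d (F : seq (max_ideal (order_ring R))) : d != 0 ->
  exists u, outside p u /\ forall q, q \in F -> q != p ->
    exists t z, [/\ outside q t, Zorder_set R z & t * u = Zemb K d * z].
Proof.
move=> d0; elim: F => [|q F [u [ou uF]]]; first by exists 1; split=> //; apply: outside1.
have Ru := outside_order ou.
have [->|qp] := eqVneq q p.
  exists u; split=> // q'; rewrite inE => /orP[/eqP->|]; first by rewrite eqxx.
  exact: uF.
have /existsNP[r /not_implyP[qr pr]] : ~ (q `<=` p).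
  by move=> /max_ideal_eq e; rewrite e eqxx in qp.
have [s [n [qs sn]]] := order_max_pow dedZ q d0.
have [z /(congr1 val)] := sn _ (ideal_pow_mem n (max_ideal_ideal q) qr).
rewrite !order_valM => srz.
exists (val (r ^+ n) * u); split.
  by apply: outsideM => //; exists (r ^+ n) => //; apply: notin_max_idealX.
move=> q'; rewrite inE => /orP[/eqP-> _|q'F q'p].
  exists (val s), (val z * u); split; first by exists s.
    by apply: orderM => //; apply: order_valP.
  by rewrite mulrA srz mulrA.
have [t [z' [ot Rz' tu]]] := uF q' q'F q'p.
exists t, (val (r ^+ n) * z'); split=> //.
  by apply: orderM => //; apply: order_valP.
by rewrite mulrCA tu mulrCA.
Qed.

(** Scaling by d_p turns G_p into an integral copy X_p in R, which changes no equivalence class. The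
    glued ideal consists of the x in R that belong to X_p locally at each p in F. *)
Lemma glue_frac_ideals (F : seq (max_ideal (order_ring R)))
    (G : max_ideal (order_ring R) -> frac_ideal R) :
  exists I, forall p, p \in F -> mul_equiv p I (G p).
Proof.
have /choice[d dP] p := lattice_denom (Zorder_lattice R) (fi_lattice (G p)).
have /choice[e eP] p := is_lattice_Zemb (fi_lattice (G p)).
pose X p : set K := [set x | exists2 g, G p g & x = Zemb K (d p) * g].
have X0 p : X p 0 by exists 0; [apply: fi0 | rewrite mulr0].
have XD p x y : X p x -> X p y -> X p (x + y).
  by move=> [g Gg ->] [g' Gg' ->]; exists (g + g'); [apply: fiD | rewrite mulrDr].
have XM p x y : Zorder_set R x -> X p y -> X p (x * y).
  by move=> Rx [g Gg ->]; exists (x * g); [apply: fi_scale | rewrite mulrCA].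
have XR p x : X p x -> Zorder_set R x by move=> [g /(proj2 (dP p)) ? ->].
(* D lies in every X_p with p in F, since e_p is an integer of G_p. So DR lies in the glued ideal,
   which is therefore a lattice. *)
pose D := \prod_(p <- F) (d p * e p).
have D0 : D != 0.
  by rewrite /D prodf_seq_neq0; apply/allP => p _; rewrite mulf_neq0 //=;
    [case: (dP p) | case: (eP p)].
have XDR p x : p \in F -> Zorder_set R x -> X p (Zemb K D * x).
  move=> pF Rx; rewrite mulrC; apply: (XM) => //.
  have [c ->] : exists c, D = c * (d p * e p).
    rewrite /D; elim: (F) pF => // q F' IHF; rewrite inE big_cons => /orP[/eqP<-|/IHF[c ->]].
      by exists (\prod_(j <- F') (d j * e j)); rewrite mulrC.
    by exists (d q * e q * c); rewrite mulrA.
  rewrite ZembM; apply: (XM); first exact: order_Zemb.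
  by exists (Zemb K (e p)); [case: (eP p) | rewrite ZembM].
pose I0 : set K := [set x | Zorder_set R x /\
  forall p, p \in F -> exists t, outside p t /\ X p (t * x)].
have scale x y : Zorder_set R x -> I0 y -> I0 (x * y).
  move=> Rx [Ry yX]; split=> [|p /yX[t [ot Xty]]]; first exact: orderM.
  by exists t; split=> //; rewrite mulrCA; apply: (XM).
have lat : is_lattice I0.
  apply: (sub_is_lattice dedZ _ D0 (Y := R)) => [|y Ry|x []//|]; last exact: Zorder_lattice.
    split=> [|x y [Rx xX] [Ry yX]|a x Ix].
    - split=> [|p _]; first exact: is_lattice0 (Zorder_lattice R).
      by exists 1; rewrite mulr0; split; [apply: outside1 | apply: X0].
    - split=> [|p pF]; first exact: orderD.
      have [t [ot Xt]] := xX p pF; have [t' [ot' Xt']] := yX p pF.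
      exists (t * t'); split; first exact: outsideM.
      have -> : t * t' * (x + y) = t' * (t * x) + t * (t' * y) by ring.
      by apply: (XD); apply: (XM) => //; [apply: outside_order ot' | apply: outside_order ot].
    - by rewrite ZscaleE; apply: scale => //; apply: order_Zemb.
  split=> [|p pF]; first by apply: orderM => //; apply: order_Zemb.
  by exists 1; rewrite mul1r; split; [apply: outside1 | apply: XDR].
exists (FracIdeal scale lat) => p pF.
have [l Il] := lat.1.
have [u [ou uF]] := avoid_other_max_ideals p F D0.
have [|t [ot tX]] := @common_multiplier _ _ _ p (X p) l (X0 p) (XD p) (XM p).
  by move=> x; rewrite -Il => -[_ /(_ p pF)].
have [b tb] := Zemb_divr t (proj1 (dP p)).
(* The factor u makes X_p land in the glued ideal, being divisible by D at the other members of F.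
   In return t carries the glued ideal into X_p, and b = t / d_p carries it into G_p. *)
exists (u * Zemb K (d p)), b; split.
- move=> g Gg; have Xg : X p (Zemb K (d p) * g) by exists g.
  rewrite -mulrA; split.
    by apply: orderM; [apply: outside_order ou | apply: XR Xg].
  move=> q qF; have [->|qp] := eqVneq q p.
    exists 1; rewrite mul1r; split; first exact: outside1.
    by apply: (XM) => //; apply: outside_order ou.
  have [t' [z [ot' Rz tu]]] := uF q qF qp; exists t'; split=> //.
  rewrite [t' * _]mulrA tu -mulrA; apply: XDR => //.
  by apply: orderM => //; apply: XR Xg.
- move=> x Ix; have [|g Gg] := tX x; first by rewrite -Il.
  by rewrite tb -mulrA => /(Zemb_inj (proj1 (dP p))) ->.
- by rewrite -mulrA -tb; apply: outsideM.
Qed.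

End Gluing.

Section Classes.
Variables (Z : idomainType) (dedZ : dedekind_domain Z) (K : comAlgType {fraction Z}).
Variables (S : Zorder K) (SS : set (max_ideal (order_ring S))).
Implicit Types (I J : frac_ideal S) (p : max_ideal (order_ring S)).

Lemma ideal_class_eqP I J :
  ideal_class SS I = ideal_class SS J <-> forall p, SS p -> mul_equiv p I J.
Proof.
split=> [/eqmodP/asboolP IJ p /IJ|IJ]; first by move=> /(p_equivalentP dedZ).
by apply/eqmodP/asboolP => p /IJ /(p_equivalentP dedZ).
Qed.

Lemma ideal_class_repr (x : ideal_classes SS) : ideal_class SS (repr x) = x.
Proof. exact: reprK. Qed.

Lemma mul_equiv_fi_mul p I I' J J' : mul_equiv p I I' -> mul_equiv p J J' ->
  mul_equiv p (fi_mul I J) (fi_mul I' J').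
Proof.
have colonM (L L' M M' : frac_ideal S) a b : colon L L' a -> colon M M' b ->
    colon (fi_mul L M) (fi_mul L' M') (a * b).
  move=> La Mb; apply: mulset_ind => [|x y|x y Lx My].
  - by rewrite mulr0; apply: mulset0.
  - by rewrite mulrDr; apply: mulsetD.
  - by rewrite mulrACA; apply: mulsetM; [apply: La | apply: Mb].
move=> [a [b [Ia Ib oab]]] [a' [b' [Ja Jb oab']]]; exists (a * a'), (b * b').
by split; [exact: colonM | exact: colonM | rewrite mulrACA; apply: outsideM].
Qed.

Lemma eq_mul_equiv p I J : I = J :> set K -> mul_equiv p I J.
Proof.
move=> IJ; exists 1, 1; rewrite mul1r; split; last exact: outside1.
  by move=> x; rewrite mul1r IJ.
by move=> x; rewrite mul1r IJ.
Qed.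

Lemma class_mul_inducedP : class_mul_induced SS.
Proof.
move=> I J; apply/ideal_class_eqP => p Sp; apply: mul_equiv_fi_mul;
by move: p Sp; apply/ideal_class_eqP; rewrite ideal_class_repr.
Qed.

End Classes.

Lemma fi_ext_mul (Z : idomainType) (K : comAlgType {fraction Z}) (R T : Zorder K)
    (I J : frac_ideal R) :
  fi_ext T (fi_mul I J) = fi_mul (fi_ext T I) (fi_ext T J) :> set K.
Proof.
apply/seteqP; split; apply: mulset_ind; try exact: mulset0; try exact: mulsetD.
  move=> x t + Tt; move: x; apply: mulset_ind => [|x y|x y Ix Jy].
  - by rewrite mul0r; apply: mulset0.
  - by rewrite mulrDl; apply: mulsetD.
  rewrite -mulrA; apply: mulsetM; last exact: mulsetM.
  by rewrite -[x]mulr1; apply: mulsetM => //; apply: order1.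
move=> x y Ix; move: y; apply: mulset_ind => [|y y'|y t' Jy Tt'].
- by rewrite mulr0; apply: mulset0.
- by rewrite mulrDr; apply: mulsetD.
move: x Ix; apply: mulset_ind => [|x x'|x t Ix Tt].
- by rewrite mul0r; apply: mulset0.
- by rewrite mulrDl; apply: mulsetD.
by rewrite mulrACA; apply: mulsetM; [apply: mulsetM | apply: orderM].
Qed.

Lemma fi_ext_one (Z : idomainType) (K : comAlgType {fraction Z}) (R T : Zorder K) :
  R `<=` T -> fi_ext T (fi_one R) = fi_one T :> set K.
Proof.
move=> RT; apply/seteqP; split=> [|x Tx].
  apply: mulset_ind => [|x y|x y Rx Ty].
  - exact: is_lattice0 (Zorder_lattice T).
  - exact: orderD.
  - by apply: orderM => //; apply: RT.
by rewrite -[x]mul1r; apply: mulsetM => //; apply: order1.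
Qed.

(** A T-ideal is already an R-ideal, and its extension is itself. This gives preimages at one T at a
    time, which are then glued. *)
Lemma fi_restrict (Z : idomainType) (K : comAlgType {fraction Z}) (R T : Zorder K)
    (B : frac_ideal T) : R `<=` T ->
  exists I : frac_ideal R, I = B :> set K /\ fi_ext T I = B :> set K.
Proof.
move=> RT.
have scale x y : Zorder_set R x -> B y -> B (x * y).
  by move=> Rx; apply: fi_scale; apply: RT.
exists (FracIdeal scale (fi_lattice B)); split=> //.
apply/seteqP; split=> [|x Bx]; last first.
  by rewrite -[x]mulr1; apply: mulsetM => //; apply: order1.
apply: mulset_ind => [|x y|x y Bx Ty]; first exact: fi0.
  exact: fiD.
by rewrite mulrC; apply: fi_scale.
Qed.

Theorem theorem4p4 (Z : idomainType) (dedZ : dedekind_domain Z)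
    (K : comAlgType {fraction Z}) (etK : etale_algebra K)
    (R O : Zorder K) (maxO : is_maximal_order O)
    (SS : set (max_ideal (order_ring R)))
    (n : max_ideal (order_ring R) -> nat)
    (n_gt0 : forall p, (0 < n p)%N)
    (n_loc : forall p,
       local_span p (pow_ext O p (n p)) `<=` local_span p R) :
  let S0 := [set p : max_ideal (order_ring R) |
               SS p /\ colon R O `<=` val @` p] in
  let T := fun p : max_ideal (order_ring R) => sum_order dedZ O p (n p) in
  [/\ finite_set S0,
      class_mul_induced SS,
      (forall p : S0,
         class_mul_induced [set: max_ideal (order_ring (T (val p)))]) &
      exists Phi : ideal_classes SS -> forall p : S0, weak_classes (T (val p)),
        [/\ (forall (I : frac_ideal R) (p : S0),
               Phi (ideal_class SS I) p =
               ideal_class setT (fi_ext (T (val p)) I)),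
            bijective Phi,
            (forall p : S0, Phi (class_one SS) p = class_one setT),
            (forall (x y : ideal_classes SS) (p : S0),
               Phi (class_mul SS x y) p =
               class_mul setT (Phi x p) (Phi y p)) &
            set_bij (local_multiplicator_classes SS)
              [set w | forall p : S0,
                         weak_multiplicator_classes (T (val p)) (w p)]
              Phi]].
Proof.
move=> S0 T.
have RO : R `<=` O by apply: maxO.
have RT p : R `<=` T p.
  by move=> x Rx; exists x, 0; rewrite addr0; split=> //; apply: mulset0.
have pO (p : max_ideal (order_ring R)) r x : p r -> O x -> T p (val r ^+ n p * x).
  move=> pr Ox; exists 0, (val r ^+ n p * x); rewrite add0r; split=> //.
    exact: is_lattice0 (Zorder_lattice R).
  apply: mulsetM => //; exists (r ^+ n p); last exact: order_valX.
  exact: ideal_pow_mem (max_ideal_ideal p) pr.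
(* The local inclusion of p^n O in R becomes s p^n O <= R for one s outside p, whence sT <= R. *)
have /choice[s sP] p : exists s, outside p s /\ forall x, T p x -> Zorder_set R (s * x).
  have [|s [os sPow]] := local_span_order_sub dedZ _ (n_loc p).
    have [t RO_t] := proj1 (is_lattice_mul (Zorder_lattice R) (Zorder_lattice O)).
    apply: (Zspan_noetherian (s := t) dedZ (pow_ext_submodule O p (n p))).
    rewrite -RO_t; apply: mulset_ind; [exact: mulset0 | exact: mulsetD |].
    by move=> _ y [a _ <-] Oy; apply: mulsetM => //; apply: order_valP.
  exists s; split=> // _ [x [y [Rx /sPow sy ->]]]; rewrite mulrDr; apply: orderD => //.
  by apply: orderM => //; apply: outside_order os.
have os p := proj1 (sP p); have sT p := proj2 (sP p).
(* The nonzero integer D is in (R:O), so each member of S0 contains D, and only finitely many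
   maximal ideals do. *)
have [D [D0 DO]] := lattice_denom (Zorder_lattice R) (Zorder_lattice O).
have finS0 : finite_set S0.
  apply: (sub_finite_set _ (finite_max_ideals_over dedZ R D0)).
  move=> p [_ /(_ (Zemb K D) DO)].
  by move=> [r pr rD]; have <- : r = Zorder_emb R D by apply: val_inj.
have regular p : SS p -> ~ S0 p -> exists2 c, outside p c & forall x, O x -> Zorder_set R (c * x).
  move=> Sp nS0; have /existsNP[c /not_implyP[Rc pc]] : ~ (colon R O `<=` val @` p).
    by move=> h; apply: nS0.
  exists c => //; apply: notin_inside => //.
  by rewrite -[c]mulr1; apply/Rc/order1.
pose Phi (x : ideal_classes SS) (p : S0) : weak_classes (T (val p)) :=
  ideal_class setT (fi_ext (T (val p)) (repr x)).
have S0P (p : S0) : S0 (val p) by apply: set_mem (valP p).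
have weak_eq (p : S0) (I J : frac_ideal R) : mul_equiv (val p) I J ->
    ideal_class setT (fi_ext (T (val p)) I) = ideal_class setT (fi_ext (T (val p)) J).
  move=> IJ; apply/(ideal_class_eqP dedZ) => q _.
  exact: (mul_equiv_fi_ext dedZ maxO (@RT _) (@pO _) q IJ).
have PhiE I (p : S0) : Phi (ideal_class SS I) p = ideal_class setT (fi_ext (T (val p)) I).
  apply: weak_eq; have /(ideal_class_eqP dedZ) := ideal_class_repr (ideal_class SS I).
  by apply; case: (S0P p).
have Phi_inj : injective Phi.
  move=> x y xy; rewrite -(ideal_class_repr x) -(ideal_class_repr y).
  apply/(ideal_class_eqP dedZ) => p Sp; have [S0p|nS0p] := pselect (S0 p); last first.
    by have [c oc cO] := regular p Sp nS0p; apply: (mul_equiv_regular dedZ maxO _ _ oc cO).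
  have := congr1 (fun f => f (SigSub (mem_set S0p : p \in S0))) xy.
  move=> /(ideal_class_eqP dedZ) IJ.
  by apply: (fi_ext_mul_equiv_inj (@RT p) (os p) (@sT p)) => q; apply: IJ.
have Phi_surj w : exists x, Phi x = w.
  (* The type of [w u] depends on u, so the ideals are indexed by all maximal ideals and constrained
     only through [val u = p], which avoids transport. Outside S0 the value is the unit ideal, as a
     default. *)
  have /choice[G GP] p : exists G : frac_ideal R, forall u : S0, val u = p ->
      fi_ext (T (val u)) G = repr (w u) :> set K.
    have [S0p|nS0p] := pselect (S0 p); last first.
      by exists (fi_one R) => u up; case: nS0p; rewrite -up; apply: S0P.
    have [G [_ GB]] := fi_restrict (repr (w (SigSub (mem_set S0p : p \in S0)))) (@RT p).
    exists G => u up; have -> : u = SigSub (mem_set S0p : p \in S0) by apply: val_inj.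
    exact: GB.
  have [F S0F] := (finite_seqP S0).1 finS0.
  have [I IP] := glue_frac_ideals dedZ F G.
  exists (ideal_class SS I); apply: functional_extensionality_dep => p.
  rewrite PhiE (weak_eq p I (G (val p))).
    rewrite -[RHS]ideal_class_repr; apply/(ideal_class_eqP dedZ) => q _.
    exact/eq_mul_equiv/GP.
  have S0_F q : S0 q -> q \in F by rewrite S0F.
  exact/IP/S0_F.
split=> //; [exact: class_mul_inducedP | by move=> p; apply: class_mul_inducedP |].
exists Phi; split=> //.
- have /choice[Psi PsiP] := Phi_surj.
  by exists Psi => // x; apply: Phi_inj; rewrite PsiP.
- move=> p; rewrite PhiE; apply/(ideal_class_eqP dedZ) => q _.
  exact/eq_mul_equiv/fi_ext_one.
- move=> x y p; rewrite -(ideal_class_repr x) -(ideal_class_repr y).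
  rewrite class_mul_inducedP // !PhiE class_mul_inducedP //.
  by apply/(ideal_class_eqP dedZ) => q _; apply/eq_mul_equiv/fi_ext_mul.
split.
- move=> _ [I IP <-] p; rewrite PhiE; exists (fi_ext (T (val p)) I) => //=.
  have [Sp _] := S0P p; have [l Il] : exists l, colon I I = Zspan l.
    by have [I' <-] := colon_order dedZ I; case: (Zorder_lattice I').
  have [||t [ot tI]] := local_span_order_sub (p := val p) dedZ (X := colon I I) _ _.
  + by exists l.
  + by rewrite IP.
  exact: (colon_fi_ext_order dedZ maxO (@RT _) (os _) (@sT _) (@pO _) ot tI).
- by move=> x y _ _; apply: Phi_inj.
move=> w wP; have [x xw] := Phi_surj w; exists x => //.
exists (repr x); last exact: ideal_class_repr.
move=> p Sp /=; apply/seteqP; split; last first.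
  move=> _ [t tR <-]; exists t => // u /tR Ru y; exact: fi_scale.
(* At p in SS but not in S0 the condition is automatic: (I:I) lies in O, which some c outside p
   carries into R. At p in S0 it is transferred from the component of w at p. *)
have [S0p|nS0p] := pselect (S0 p); last first.
  have [c oc cO] := regular p Sp nS0p; apply: (sub_local_span_order oc) => y.
  by move=> /(colon_sub_maximal dedZ maxO); apply: cO.
pose u : S0 := SigSub (mem_set S0p : p \in S0).
have [B BT Bw] := wP u.
have [|t [ot tI]] := colon_order_of_fi_ext (@RT p) (os p) (@sT p) (I := repr x) (B := B) _ BT.
  move=> q; move: q (Logic.I : [set: max_ideal _] q); apply/(ideal_class_eqP dedZ).
  by rewrite Bw -xw.
exact: (sub_local_span_order ot).
Qed.
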